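(* Let $R$ be a commutative Noetherian semiperfect ring, let $C$ be a semidualizing $R$-module, and let $M$ be a reduced $\mathrm{G}_C$-perfect $R$-module of $\mathrm{G}_C$-dimension $n$. Then $$\mathrm{r.grade}_R(M,C)+\mathrm{r.grade}_R(\mathrm{Tr}_C(M),C)=\mathrm{grade}_R(\mathrm{Ext}_R^n(M,C))+1.$$
   Context: A commutative Noetherian ring is semiperfect iff it is a finite direct product of local rings. ''Finite'' module means finitely generated. A finite $R$-module $C$ is semidualizing if the homothety map $R\to\mathrm{Hom}_R(C,C)$ is an isomorphism and $\mathrm{Ext}^i_R(C,C)=0$ for all $i>0$. Write $(-)^C=\mathrm{Hom}_R(-,C)$. A finite module $X$ is totally $C$-reflexive if the biduality map $X\to X^{CC}$ is an isomorphism and $\mathrm{Ext}^i_R(X,C)=\mathrm{Ext}^i_R(X^C,C)=0$ for all $i>0$. For a finite module $M$, $\mathrm{G}_C\text{-}\dim_R(M)$ is the smallest $n\ge 0$ such that there is an exact sequence $0\to X_n\to\cdots\to X_0\to M\to 0$ with all $X_i$ totally $C$-reflexive, and $\infty$ if no such $n$ exists. $\mathrm{grade}_R(M)=\inf\{i\ge 0\mid \mathrm{Ext}^i_R(M,R)\ne 0\}$ and $\mathrm{r.grade}_R(M,C)=\inf\{i>0\mid \mathrm{Ext}^i_R(M,C)\ne 0\}$ (with $\inf\emptyset=\infty$). A finite module $M$ with finite $\mathrm{G}_C$-dimension is reduced $\mathrm{G}_C$-perfect if $\mathrm{r.grade}_R(M,C)=\mathrm{G}_C\text{-}\dim_R(M)$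 (so its $\mathrm{G}_C$-dimension is automatically positive). If $P_1\xrightarrow{f}P_0\to M\to 0$ is a presentation by finite projective modules, $\mathrm{Tr}_C(M)=\mathrm{Coker}(f^C\colon P_0^C\to P_1^C)$; it is unique up to adding direct summands of finite direct sums of copies of $C$, and its reduced grade with respect to $C$ does not depend on the choice. *)

(* Defs.v *)
From HB Require Import structures.
From mathcomp Require Import all_boot all_algebra finmap.
From mathcomp Require Import boolp classical_sets functions cardinality fsbigop.
From mathcomp Require Import constructive_ereal.

Set Implicit Arguments.
Unset Strict Implicit.
Unset Printing Implicit Defensive.
Import GRing.Theory.
Local Open Scope ring_scope.

Section Rings.
Variable R : comPzRingType.

Definition is_ideal (I : set R) : Prop :=
  [/\ I 0, forall x y, I x -> I y -> I (x + y) & forall a x, I x -> I (a * x)].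

Definition noetherian : Prop := forall I : set R, is_ideal I ->
  exists (n : nat) (a : 'I_n -> R),
    forall x, I x <-> exists c : 'I_n -> R, x = \sum_i c i * a i.

Definition maximal_ideal (I : set R) : Prop :=
  [/\ is_ideal I, I <> setT &
    forall J : set R, is_ideal J -> (I `<=` J)%classic -> J = I \/ J = setT].

Definition local_ring : Prop := exists! I : set R, maximal_ideal I.

End Rings.

(* The projections [p i] exhibit [R] as the product of the [S i]; the empty
   product (the zero ring) is allowed. *)
Definition semiperfect (R : comPzRingType) : Prop :=
  exists (k : nat) (S : 'I_k -> comPzRingType)
         (p : forall i, {rmorphism R -> S i}),
    (forall i, local_ring (S i)) /\
    (forall s : (forall i, S i), exists! r : R, forall i, p i r = s i).

Section Submodule.
Variables (R : pzRingType) (V : lmodType R) (S : submodClosed V).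

Record submod := Submod { submod_val : V; _ : submod_val \in S }.
HB.instance Definition _ := [isSub for submod_val].
HB.instance Definition _ := [Choice of submod by <:].
HB.instance Definition _ := [SubChoice_isSubLmodule of submod by <:].

End Submodule.

Section QuotientModule.
Variables (R : pzRingType) (V : lmodType R) (S : submodClosed V).

(* [S] as a [zmodClosed], which [submodClosed] does not inherit. *)
Definition quotmod_pred : {pred V} := S.
HB.instance Definition _ := GRing.isZmodClosed.Build V quotmod_pred
  (GRing.submod_closedB (GRing.submodClosedP S)).

Definition quotmod := Quotient.quot quotmod_pred.
HB.instance Definition _ := GRing.Zmodule.on quotmod.

Definition quotmod_pi (x : V) : quotmod :=
  \pi_(Quotient.quot quotmod_pred)%qT x.
Definition quotmod_scale (a : R) (x : quotmod) : quotmod :=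
  quotmod_pi (a *: repr x).

Lemma quotmod_piP (x y : V) : quotmod_pi x = quotmod_pi y <-> x - y \in S.
Proof.
rewrite -[x - y \in S]/(x - y \in quotmod_pred).
by rewrite Quotient.idealrBE; split=> [E|/eqP//]; apply/eqP.
Qed.

Lemma quotmod_pi_repr (x : quotmod) : quotmod_pi (repr x) = x.
Proof. exact: reprK. Qed.

Lemma quotmod_piD (x y : V) :
  quotmod_pi (x + y) = quotmod_pi x + quotmod_pi y.
Proof. exact: (raddfD \pi_(Quotient.quot quotmod_pred)%qT). Qed.

Lemma quotmod_piZ a (x : V) :
  quotmod_pi (a *: x) = quotmod_scale a (quotmod_pi x).
Proof.
apply/quotmod_piP; rewrite -scalerBr rpredZ //.
by apply/quotmod_piP; rewrite quotmod_pi_repr.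
Qed.

Fact quotmod_scaleA a b x :
  quotmod_scale a (quotmod_scale b x) = quotmod_scale (a * b) x.
Proof. by rewrite -[x]quotmod_pi_repr -!quotmod_piZ scalerA. Qed.
Fact quotmod_scale1 : left_id 1 quotmod_scale.
Proof. by move=> x; rewrite -[x]quotmod_pi_repr -quotmod_piZ scale1r. Qed.
Fact quotmod_scaleDr : right_distributive quotmod_scale +%R.
Proof.
move=> a x y; rewrite -[x]quotmod_pi_repr -[y]quotmod_pi_repr.
by rewrite -quotmod_piD -!quotmod_piZ scalerDr quotmod_piD.
Qed.
Fact quotmod_scaleDl x :
  {morph quotmod_scale^~ x : a b / a + b >-> a + b}.
Proof.
move=> a b; rewrite -[x]quotmod_pi_repr.
by rewrite -!quotmod_piZ scalerDl quotmod_piD.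
Qed.
HB.instance Definition _ := GRing.Zmodule_isLmodule.Build R quotmod
  quotmod_scaleA quotmod_scale1 quotmod_scaleDr quotmod_scaleDl.

Fact quotmod_pi_linear : linear quotmod_pi.
Proof. by move=> a x y; rewrite quotmod_piD quotmod_piZ. Qed.
HB.instance Definition _ :=
  GRing.isLinear.Build R V quotmod *:%R quotmod_pi quotmod_pi_linear.

End QuotientModule.

Section KernelImage.
Variables (R : pzRingType) (U V : lmodType R) (f : {linear U -> V}).

Definition ker_pred : {pred U} := [pred x | f x == 0].
Fact ker_submod : submod_closed ker_pred.
Proof.
split=> [|a x y]; rewrite !inE ?linear0 // => /eqP fx /eqP fy.
by rewrite linearP fx fy scaler0 addr0.
Qed.
HB.instance Definition _ := GRing.isSubmodClosed.Build R U ker_pred ker_submod.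

Definition im_pred : {pred V} := fun y => `[< exists x, f x = y >].
Fact im_submod : submod_closed im_pred.
Proof.
split=> [|a x y].
  by apply/asboolP; exists 0; rewrite linear0.
move=> /asboolP[u <-] /asboolP[v <-]; apply/asboolP.
by exists (a *: u + v); rewrite linearP.
Qed.
HB.instance Definition _ := GRing.isSubmodClosed.Build R V im_pred im_submod.

Definition ker_mod : lmodType R := submod ker_pred.
Definition coker_mod : lmodType R := quotmod im_pred.

End KernelImage.

Section Homology.
Variables (R : pzRingType) (U V W : lmodType R).
Variables (f : {linear U -> V}) (g : {linear V -> W}).

Definition boundary_pred : {pred ker_mod g} :=
  [pred z | val z \in im_pred f].
Fact boundary_submod : submod_closed boundary_pred.
Proof.
have E z : (z \in boundary_pred) = (val z \in im_pred f) by [].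
split=> [|a x y]; rewrite !E ?linear0 ?rpred0 // linearP => fx fy.
by rewrite rpredD // rpredZ.
Qed.
HB.instance Definition _ :=
  GRing.isSubmodClosed.Build R (ker_mod g) boundary_pred boundary_submod.

Definition homology : lmodType R := quotmod boundary_pred.

End Homology.

Section HomModule.
Variables (R : comPzRingType) (M N : lmodType R).

Definition linear_pred : {pred (M -> N)} := fun f => `[< linear f >].
Fact linear_submod : submod_closed linear_pred.
Proof.
split=> [|a f g].
  by apply/asboolP => b u v /=; rewrite scaler0 addr0.
move=> /asboolP lf /asboolP lg; apply/asboolP => b u v.
rewrite !(addrfctE, scalrfctE) lf lg !scalerDr !scalerA mulrC.
by rewrite addrACA.
Qed.
HB.instance Definition _ :=
  GRing.isSubmodClosed.Build R (M -> N) linear_pred linear_submod.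

Definition Hom : lmodType R := submod linear_pred.

Definition hom_fun (f : Hom) : M -> N := submod_val f.
Fact hom_fun_linear (f : Hom) : linear (hom_fun f).
Proof. by case: f => f /= /asboolP. Qed.
HB.instance Definition _ (f : Hom) :=
  GRing.isLinear.Build R M N *:%R (hom_fun f) (hom_fun_linear f).

Definition to_hom (f : M -> N) (lf : linear f) : Hom :=
  Submod (asboolT lf : f \in (linear_pred : submodClosed _)).

Lemma homP (f g : Hom) : hom_fun f =1 hom_fun g -> f = g.
Proof. by move=> fg; apply: val_inj; apply/funext. Qed.

End HomModule.

Section Precomposition.
Variables (R : comPzRingType) (U V C : lmodType R) (f : {linear U -> V}).

Fact precomp_subproof (h : Hom V C) : linear (hom_fun h \o f).
Proof. by move=> a x y /=; rewrite !linearP. Qed.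
Definition precomp (h : Hom V C) : Hom U C := to_hom (precomp_subproof h).
Fact precomp_linear : linear precomp.
Proof. by move=> a g h; apply: homP. Qed.
HB.instance Definition _ :=
  GRing.isLinear.Build R (Hom V C) (Hom U C) *:%R precomp precomp_linear.

End Precomposition.
Arguments precomp {R U V} C f h.

Section Resolutions.
Variable R : comPzRingType.
Implicit Types M N P U V W : lmodType R.

Definition surj (U V : Type) (f : U -> V) : Prop := forall y, exists x, f x = y.

Definition exact_at U V W (f : {linear U -> V}) (g : {linear V -> W}) : Prop :=
  forall y, g y = 0 <-> exists x, f x = y.

Definition is_zero M : Prop := forall x : M, x = 0.

Definition fin_module M : Prop :=
  exists (n : nat) (g : 'I_n -> M),
    forall x, exists c : 'I_n -> R, x = \sum_i c i *: g i.

Definition projective P : Prop :=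
  forall U V (g : {linear U -> V}) (f : {linear P -> V}),
    surj g -> exists h : {linear P -> U}, forall x, g (h x) = f x.

Record resolution M := Resolution {
  res_term : nat -> lmodType R;
  res_diff : forall i, {linear res_term i.+1 -> res_term i};
  res_aug : {linear res_term 0 -> M};
  res_surj : surj res_aug;
  res_exact0 : exact_at (res_diff 0) res_aug;
  res_exactS : forall i, exact_at (res_diff i.+1) (res_diff i)
}.

Definition projective_resolution M (F : resolution M) : Prop :=
  forall i, projective (res_term F i).

(* H^i of the deleted complex Hom(F, N): [M] itself is dropped, so in degree 0
   the incoming map is zero. *)
Definition ext_of M (F : resolution M) N (i : nat) : lmodType R :=
  match i with
  | 0 => homology (\0 : {linear Hom (res_term F 0) N -> Hom (res_term F 0) N})
                  (precomp N (res_diff F 0))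
  | j.+1 => homology (precomp N (res_diff F j)) (precomp N (res_diff F j.+1))
  end.

End Resolutions.

(* The free module on [X]: finitely supported functions [X -> R]. *)
Section FreeModule.
Variables (R : comPzRingType) (X : choiceType).

Definition fsupp_pred : {pred (X -> R^o)} :=
  fun f => `[< finite_set [set x | f x <> 0] >].
Fact fsupp_submod : submod_closed fsupp_pred.
Proof.
split=> [|a f g].
  by apply/asboolP; apply: (sub_finite_set _ (finite_set0 X)) => x /= /(_ erefl).
move=> /asboolP ff /asboolP fg; apply/asboolP.
have fU : finite_set ([set x | f x <> 0] `|` [set x | g x <> 0])%classic.
  by rewrite finite_setU.
apply: (sub_finite_set _ fU) => x /= h.
have [fx|fx] := pselect (f x = 0); last by left.
right=> gx; apply: h.
by rewrite addrfctE scalrfctE fx gx scaler0 addr0.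
Qed.
HB.instance Definition _ :=
  GRing.isSubmodClosed.Build R (X -> R^o) fsupp_pred fsupp_submod.

Definition free_mod : lmodType R := submod fsupp_pred.

Definition free_coef (z : free_mod) (x : X) : R := submod_val z x.

Lemma free_coefP (y z : free_mod) : free_coef y =1 free_coef z -> y = z.
Proof. by move=> yz; apply: val_inj; apply/funext. Qed.

Definition free_supp (z : free_mod) : set X := [set x | free_coef z x <> 0].

Lemma free_supp_finite z : finite_set (free_supp z).
Proof. by have /asboolP := valP z. Qed.

Section Lift.
Variables (A : lmodType R) (a : X -> A).

Definition free_lift (z : free_mod) : A :=
  (\sum_(x \in setT) free_coef z x *: a x)%R.

Lemma free_liftE (B : set X) z : finite_set B -> (free_supp z `<=` B)%classic ->
  free_lift z = \sum_(x \in B) free_coef z x *: a x.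
Proof.
move=> finB sB; rewrite /free_lift; apply/esym/fsbig_widen => // x [_ nB] /=.
have -> : free_coef z x = 0 by apply: contrapT => /sB.
by rewrite scale0r.
Qed.

Fact free_lift_linear : linear free_lift.
Proof.
move=> c y z.
set B := (free_supp y `|` free_supp z)%classic.
have finB : finite_set B by rewrite finite_setU; split; exact: free_supp_finite.
rewrite (@free_liftE B y) ?(@free_liftE B z) //; [|by move=> x; right|by move=> x; left].
rewrite (@free_liftE B) //; last first.
  move=> x /= h; have [yx|yx] := pselect (free_coef y x = 0); last by left.
  right=> zx; apply: h.
  rewrite /free_coef/= in yx zx *.
  by rewrite addrfctE scalrfctE yx zx scaler0 addr0.
rewrite !fsbig_finite //= scaler_sumr -big_split /=.
apply: eq_bigr => x _; rewrite scalerA -scalerDl.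
by [].
Qed.
HB.instance Definition _ :=
  GRing.isLinear.Build R free_mod A *:%R free_lift free_lift_linear.

End Lift.

Fact free_basis_subproof (x : X) : (fun y => (y == x)%:R : R^o) \in fsupp_pred.
Proof.
apply/asboolP; apply: (sub_finite_set _ (finite_set1 x)) => y /=.
by case: eqP.
Qed.
Definition free_basis (x : X) : free_mod := Submod (free_basis_subproof x).

Lemma free_lift_basis (A : lmodType R) (a : X -> A) x :
  free_lift a (free_basis x) = a x.
Proof.
rewrite (@free_liftE _ _ [set x]%classic) ?fsbig_set1 //=.
  by rewrite /free_coef/= eqxx scale1r.
by move=> y; rewrite /free_supp /free_coef /=; case: eqP.
Qed.

Lemma free_lift_id z : free_lift free_basis z = z.
Proof.
apply: free_coefP => y.
have finz := free_supp_finite z.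
rewrite (@free_liftE _ _ (free_supp z)) // fsbig_finite //=.
rewrite (big_morph (free_coef^~ y) (id1 := 0) (op1 := +%R)) //.
have coefE x : free_coef (free_coef z x *: free_basis x) y =
    free_coef z x * (y == x)%:R by [].
under eq_bigr do rewrite coefE.
have [zy|zy] := pselect (free_coef z y = 0).
  rewrite zy big1 // => x _; case: eqP => [<-|_]; by rewrite ?zy ?mul0r ?mulr0.
have yz : y \in fset_set (free_supp z) by rewrite in_fset_set // inE.
rewrite (bigD1_seq y) //= eqxx mulr1 big1 ?addr0 // => x.
by rewrite eq_sym => /negPf ->; rewrite mulr0.
Qed.

Lemma free_projective : projective free_mod.
Proof.
move=> U V g f gs.
have [a ga] := choice (fun x => gs (f (free_basis x))).
exists (free_lift a) => z /=.
have finz := free_supp_finite z.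
rewrite -{2}[z]free_lift_id !(@free_liftE _ _ (free_supp z)) //.
rewrite !fsbig_finite //= !linear_sum.
by apply: eq_bigr => x _; rewrite !linearZ /= ga.
Qed.

End FreeModule.

Section StandardResolution.
Variables (R : comPzRingType) (M : lmodType R).

(* The canonical surjection from the free module on (the set of elements
   of) [N]. *)
Definition free_cover (N : lmodType R) : {linear free_mod R N -> N} :=
  free_lift (idfun : N -> N).

Lemma free_cover_surj (N : lmodType R) : surj (free_cover N).
Proof. by move=> x; exists (free_basis R x); rewrite /= free_lift_basis. Qed.

Fixpoint syzygy (i : nat) : lmodType R :=
  if i is j.+1 then ker_mod (free_cover (syzygy j)) else M.

Definition std_term (i : nat) : lmodType R := free_mod R (syzygy i).

Definition std_diff (i : nat) : {linear std_term i.+1 -> std_term i} :=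
  (val : ker_mod (free_cover (syzygy i)) -> free_mod R (syzygy i))
    \o free_cover (syzygy i.+1).

Fact std_diff_im (i : nat) : exact_at (std_diff i) (free_cover (syzygy i)).
Proof.
move=> y; split=> [y0|[x <-]].
  have yK : y \in ker_pred (free_cover (syzygy i)) by apply/eqP.
  have [x xy] := @free_cover_surj (syzygy i.+1) (Submod yK).
  by exists x; rewrite /std_diff /= xy.
exact/eqP/(valP (free_cover (syzygy i.+1) x)).
Qed.

Fact std_exactS (i : nat) : exact_at (std_diff i.+1) (std_diff i).
Proof.
move=> y; rewrite -std_diff_im; split=> [y0|y0]; last first.
  by rewrite /std_diff [LHS]/= y0.
by apply: val_inj; rewrite linear0.
Qed.

Definition std_resolution : resolution M :=
  Resolution (@free_cover_surj M) (@std_diff_im 0) std_exactS.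

Lemma std_resolution_projective : projective_resolution std_resolution.
Proof. by move=> i; exact: free_projective. Qed.

End StandardResolution.

(* [Ext] is computed from one functorial free resolution, which makes it a
   function of all modules; any projective resolution gives the same module up
   to isomorphism. *)
Definition Ext (R : comPzRingType) (M N : lmodType R) (i : nat) : lmodType R :=
  ext_of (std_resolution M) N i.

Definition inf_nat (P : nat -> Prop) : \bar nat :=
  match pselect (exists i, `[< P i >]) with
  | left exP => (ex_minn exP)%:E
  | right _ => +oo%E
  end.

Section Gorenstein.
Variable R : comPzRingType.
Implicit Types C M N X : lmodType R.

Definition grade M : \bar nat := inf_nat (fun i => ~ is_zero (Ext M R^o i)).

Definition rgrade M C : \bar nat :=
  inf_nat (fun i => (0 < i)%N /\ ~ is_zero (Ext M C i)).

Fact homothety_subproof C (a : R) : linear (fun x : C => a *: x).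
Proof. by move=> b x y; rewrite scalerDr !scalerA mulrC. Qed.
Definition homothety C (a : R^o) : Hom C C := to_hom (@homothety_subproof C a).
Fact homothety_linear C : linear (@homothety C).
Proof. by move=> b x y; apply: homP => z; rewrite /= scalerDl scalerA. Qed.
HB.instance Definition _ C :=
  GRing.isLinear.Build R R^o (Hom C C) *:%R (@homothety C) (@homothety_linear C).

Definition semidualizing C : Prop :=
  [/\ fin_module C, bijective (@homothety C) &
    forall i, (0 < i)%N -> is_zero (Ext C C i)].

Fact eval_subproof C X (x : X) : linear (fun f : Hom X C => hom_fun f x).
Proof. by []. Qed.
Definition biduality C X (x : X) : Hom (Hom X C) C :=
  to_hom (@eval_subproof C X x).
Fact biduality_linear C X : linear (@biduality C X).
Proof. by move=> a x y; apply: homP => f; rewrite /= linearP. Qed.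
HB.instance Definition _ C X :=
  GRing.isLinear.Build R X (Hom (Hom X C) C) *:%R (@biduality C X)
    (@biduality_linear C X).

Definition totally_reflexive C X : Prop :=
  [/\ fin_module X, bijective (@biduality C X),
    forall i, (0 < i)%N -> is_zero (Ext X C i) &
    forall i, (0 < i)%N -> is_zero (Ext (Hom X C) C i)].

(* An exact sequence 0 -> X_n -> ... -> X_0 -> M -> 0 is encoded as a
   resolution whose terms vanish beyond n. *)
Definition has_GC_resolution C M (n : nat) : Prop :=
  exists F : resolution M, forall i,
    ((i <= n)%N -> totally_reflexive C (res_term F i)) /\
    ((n < i)%N -> is_zero (res_term F i)).

Definition GCdim C M : \bar nat := inf_nat (has_GC_resolution C M).

Definition reduced_GC_perfect C M : Prop :=
  [/\ fin_module M, GCdim C M <> +oo%E & rgrade M C = GCdim C M].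

Definition finite_presentation (P1 P0 M : lmodType R)
    (f : {linear P1 -> P0}) (e : {linear P0 -> M}) : Prop :=
  [/\ fin_module P1 /\ projective P1, fin_module P0 /\ projective P0,
    exact_at f e & surj e].

(* Tr_C(M) computed from the presentation map [f : P1 -> P0]. *)
Definition Tr C (P1 P0 : lmodType R) (f : {linear P1 -> P0}) : lmodType R :=
  coker_mod (precomp C f).

End Gorenstein.

(* Main.v *)
(* Write T = Tr_C(M), E = Ext^n(M, C) and K for the complex obtained by
   augmenting Hom(F, C), F a resolution of Hom(M, C), by the biduality map of M;
   its cohomology is Ker and Coker of M -> M^CC followed by Ext^i(M^C, C), i > 0.
   Dualizing 0 -> M^C -> P_0^C -> P_1^C -> T -> 0 gives Ext^(i+1)(T, C) = H^i(K).
   Since Ext^j(M, C) = 0 for 0 < j < n, dualizing a G_C-resolution X of M gives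
   an exact sequence 0 -> M^C -> X_0^C -> ... -> X_n^C -> E -> 0, whence
   Ext^(n+i)(E, C) = H^i(K) and Ext^j(E, C) = 0 for j < n.  So r.grade(T, C) and
   the least k with Ext^k(E, C) <> 0 differ by n - 1.  Finally that k is the
   grade of E: if Ext^i(E, C) = 0 for i < k then
   Ext^k(E, R) = Hom(C, Ext^k(E, C)), and Hom(C, X) <> 0 for every X <> 0 because
   C is finitely generated and faithful over the Noetherian ring R. *)
Require Import Defs.
From mathcomp Require Import all_boot all_algebra.
From mathcomp Require Import boolp classical_sets.
From mathcomp Require Import constructive_ereal.

Set Implicit Arguments.
Unset Strict Implicit.
Unset Printing Implicit Defensive.
Import GRing.Theory.
Local Open Scope ring_scope.

(** * Linear maps, short exact sequences and pullbacks *)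

Section LinearMaps.
Variable R : comPzRingType.
Implicit Types A B Q N U V W E : lmodType R.

Definition ses A B Q (a : {linear A -> B}) (b : {linear B -> Q}) : Prop :=
  [/\ injective a, surj b & exact_at a b].

Definition extends A B (a : {linear A -> B}) N : Prop :=
  forall f : {linear A -> N}, exists g : {linear B -> N}, forall x, g (a x) = f x.

Definition lmod_iso U V : Prop :=
  exists2 f : {linear U -> V}, injective f & surj f.

Lemma linear_inj0 U V (f : {linear U -> V}) :
  (forall x, f x = 0 -> x = 0) -> injective f.
Proof.
move=> f0 x y fxy; apply/eqP; rewrite -subr_eq0; apply/eqP/f0.
by rewrite linearB fxy subrr.
Qed.

Lemma linear_of_fun U V (f : U -> V) :
  linear f -> exists g : {linear U -> V}, forall x, g x = f x.
Proof. by move=> lf; exists (hom_fun (to_hom lf)). Qed.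

Lemma linear_lift A B U (a : {linear A -> B}) (g : {linear U -> B}) :
  injective a -> (forall u, exists x, a x = g u) ->
  exists h : {linear U -> A}, forall u, a (h u) = g u.
Proof.
move=> ai ga; have [h hE] := choice ga.
have lh : linear h by move=> c u v; apply: ai; rewrite linearP !hE linearP.
by have [k kE] := linear_of_fun lh; exists k => u; rewrite kE hE.
Qed.

Lemma linear_desc B Q N (b : {linear B -> Q}) (g : {linear B -> N}) :
  surj b -> (forall y, b y = 0 -> g y = 0) ->
  exists h : {linear Q -> N}, forall y, h (b y) = g y.
Proof.
move=> bs bg; have [s sE] := choice bs.
have gE y z : b y = b z -> g y = g z.
  move=> byz; apply/eqP; rewrite -subr_eq0 -linearB; apply/eqP/bg.
  by rewrite linearB byz subrr.
have lh : linear (g \o s).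
  by move=> c u v /=; rewrite -linearP; apply: gE; rewrite linearP !sE.
have [k kE] := linear_of_fun lh; exists k => y; rewrite kE /=.
by apply: gE; rewrite sE.
Qed.

Lemma lmod_iso_refl U : lmod_iso U U.
Proof. by exists (idfun : {linear U -> U}) => // x; exists x. Qed.

Lemma lmod_iso_sym U V : lmod_iso U V -> lmod_iso V U.
Proof.
move=> [f fi fs].
have [g gE] := @linear_lift _ _ _ f (idfun : {linear V -> V}) fi fs.
exists g => [x y /(congr1 f)|x]; first by rewrite !gE.
by exists (f x); apply: fi; rewrite gE.
Qed.

Lemma lmod_iso_trans U V W : lmod_iso U V -> lmod_iso V W -> lmod_iso U W.
Proof.
move=> [f fi fs] [g gi gs]; exists (g \o f : {linear U -> W}).
  by move=> x y /gi/fi.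
by move=> z; have [y <-] := gs z; have [x <-] := fs y; exists x.
Qed.

(** Both targets are the quotient of [U] by the same submodule. Cokernels and homology modules are
    compared this way, without writing a map between them. *)
Lemma lmod_iso_covers U V W (p : {linear U -> V}) (q : {linear U -> W}) :
  surj p -> surj q -> (forall u, p u = 0 <-> q u = 0) -> lmod_iso V W.
Proof.
move=> ps qs pq.
have [f fE] := linear_desc ps (fun u => (pq u).1).
exists f => [|w].
  apply: linear_inj0 => v; have [u <-] := ps v.
  by rewrite fE => /pq.
by have [u <-] := qs w; exists (p u).
Qed.

Lemma is_zero_iso U V : lmod_iso U V -> is_zero U <-> is_zero V.
Proof.
move=> [f fi fs]; split=> z0 x.
  by have [y <-] := fs x; rewrite (z0 y) linear0.
by apply: fi; rewrite linear0; apply: z0.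
Qed.

Lemma quotmod_pi0 V (S : submodClosed V) (x : V) :
  quotmod_pi S x = 0 <-> x \in S.
Proof. by rewrite -[0](linear0 (quotmod_pi S)) quotmod_piP subr0. Qed.

Lemma quotmod_pi_surj V (S : submodClosed V) : surj (quotmod_pi S).
Proof. by move=> x; exists (repr x); rewrite quotmod_pi_repr. Qed.

Lemma coker_pi0 U V (f : {linear U -> V}) y :
  quotmod_pi (im_pred f) y = 0 <-> exists x, f x = y.
Proof. by rewrite quotmod_pi0; split=> [/asboolP|h] //; apply/asboolP. Qed.

Lemma is_zero_homology U V W (f : {linear U -> V}) (g : {linear V -> W}) :
  is_zero (homology f g) <-> forall y, g y = 0 -> exists x, f x = y.
Proof.
split=> [z0 y gy|ex x].
  have yk : y \in ker_pred g by apply/eqP.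
  have /quotmod_pi0/asboolP // :
    (quotmod_pi _ (Submod yk) : homology f g) = 0 by exact: z0.
have [[y yk] <-] := quotmod_pi_surj x; apply/quotmod_pi0.
by apply/asboolP; apply: ex; apply/eqP.
Qed.

Lemma ker_ses U V (f : {linear U -> V}) :
  surj f -> ses (val : {linear ker_mod f -> U}) f.
Proof.
move=> fs; split=> // [|y]; first exact: val_inj.
split=> [fy|[x <-]]; last exact/eqP/(valP x).
have yk : y \in ker_pred f by apply/eqP.
by exists (Submod yk).
Qed.

Lemma ses0 A B Q (a : {linear A -> B}) (b : {linear B -> Q}) x :
  ses a b -> b (a x) = 0.
Proof. by move=> [_ _ ex]; apply/ex; exists x. Qed.

Lemma extendsP A B (a : {linear A -> B}) N :
  extends a N <-> surj (precomp N a).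
Proof.
split=> [ex f|ex f].
  have [g gE] := ex (hom_fun f : {linear A -> N}).
  by exists (to_hom (linearP g)); apply: homP => x; exact: gE.
have [g gE] := ex (to_hom (linearP f)); exists (hom_fun g : {linear B -> N}) => x.
by have /(congr1 (fun h => hom_fun h x)) := gE.
Qed.

Lemma ses_coker U V (f : {linear U -> V}) (injf : injective f) :
  ses f (quotmod_pi (im_pred f)).
Proof. split=> // [|y]; [exact: quotmod_pi_surj|exact: coker_pi0]. Qed.

(** [Y] is the fibre product of [B] and [B'] over [Q], realized as the kernel of [b u.1 - b' u.2].
    Being an extension of [B'] by [A] and of [B] by [A'], it compares two sequences ending in [Q],
    as in Schanuel's lemma. *)
Lemma pullback_ses A B A' B' Q (a : {linear A -> B}) (b : {linear B -> Q})
    (a' : {linear A' -> B'}) (b' : {linear B' -> Q}) :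
  ses a b -> ses a' b' ->
  exists (Y : lmodType R) (p : {linear Y -> B}) (p' : {linear Y -> B'})
         (i : {linear A -> Y}) (i' : {linear A' -> Y}),
    [/\ ses i p', ses i' p, forall x, p (i x) = a x, forall x, p' (i' x) = a' x
      & (forall y, b (p y) = b' (p' y)) /\
        (forall u v, b u = b' v -> exists y, p y = u /\ p' y = v)].
Proof.
move=> sab sab'; have [ai bs ex] := sab; have [ai' bs' ex'] := sab'.
have ld : linear (fun u : B * B' => b u.1 - b' u.2).
  by move=> c [u1 u2] [v1 v2] /=; rewrite !linearP /= scalerBr scalerN addrACA.
have [d dE] := linear_of_fun ld.
have injK (u : B * B') : b u.1 = b' u.2 -> u \in ker_pred d.
  by move=> bu; apply/eqP; rewrite dE bu subrr.
have valK (y : ker_mod d) : b (val y).1 = b' (val y).2.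
  have /eqP := valP y; rewrite dE => /eqP.
  by rewrite subr_eq0 => /eqP.
have ka x : (a x, 0) \in ker_pred d.
  by apply: injK; rewrite /= linear0; apply/ex; exists x.
have ka' x : (0, a' x) \in ker_pred d.
  by apply: injK; rewrite /= linear0; apply/esym/ex'; exists x.
have li : linear (fun x => Submod (ka x) : ker_mod d).
  move=> c u v; apply: val_inj => /=.
  by rewrite linearP /=; congr pair; rewrite /= scaler0 addr0.
have li' : linear (fun x => Submod (ka' x) : ker_mod d).
  move=> c u v; apply: val_inj => /=.
  by rewrite linearP /=; congr pair; rewrite /= scaler0 addr0.
have [i iE] := linear_of_fun li; have [i' iE'] := linear_of_fun li'.
have lp : linear (fun y : ker_mod d => (val y).1) by [].
have lp' : linear (fun y : ker_mod d => (val y).2) by [].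
have [p pE] := linear_of_fun lp; have [p' pE'] := linear_of_fun lp'.
exists (ker_mod d), p, p', i, i'.
split=> [||x|x|] /=; rewrite ?iE ?iE' ?pE ?pE' //; last first.
- split=> [y|u v buv]; first by rewrite pE pE'.
  by exists (Submod (injK (u, v) buv)); rewrite pE pE'.
- split=> [x y||y] /=.
  + by rewrite !iE' => /(congr1 val) [/ai'].
  + move=> u; have [v bv] := bs' (b u).
    by exists (Submod (injK (u, v) (esym bv))); rewrite pE.
  split=> [|[x <-]]; last by rewrite iE' pE.
  rewrite pE; case: y => [[u v] yk] /= y0.
  have [|x xE] := (ex' v).1; first by have /= := valK (Submod yk); rewrite y0 linear0.
  by exists x; rewrite iE'; apply: val_inj; rewrite /= xE y0.
- split=> [x y||y] /=.
  + by rewrite !iE => /(congr1 val) [/ai].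
  + move=> v; have [u bu] := bs (b' v).
    by exists (Submod (injK (u, v) bu)); rewrite pE'.
  split=> [|[x <-]]; last by rewrite iE pE'.
  rewrite pE'; case: y => [[u v] yk] /= y0.
  have [|x xE] := (ex u).1; first by have /= := valK (Submod yk); rewrite y0 linear0.
  by exists x; rewrite iE; apply: val_inj; rewrite /= xE y0.
Qed.

End LinearMaps.

(** * Ext along short exact sequences *)

Section ExtSequences.
Variable R : comPzRingType.
Implicit Types A B K N P Q U V W Y : lmodType R.

(** Vanishing of Ext^1 phrased over all sequences ending in [Q], hence without choosing a
    resolution; [Ext1_null] links it to [Ext]. *)
Definition ext1_null Q N : Prop :=
  forall A B (a : {linear A -> B}) (b : {linear B -> Q}),
    ses a b -> extends a N.

Definition acyclic N Q : Prop := forall j, is_zero (Ext Q N j.+1).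

Definition syz_incl Q : {linear ker_mod (free_cover Q) -> free_mod R Q} := val.

Lemma syz_ses Q : ses (syz_incl Q) (free_cover Q).
Proof. exact: ker_ses (@free_cover_surj R Q). Qed.

Lemma splitting A B P (a : {linear A -> B}) (b : {linear B -> P}) :
  projective P -> ses a b ->
  exists r : {linear B -> A}, forall x, r (a x) = x.
Proof.
move=> pP [ai bs ex].
have [s sE] := pP _ _ b (idfun : {linear P -> P}) bs.
have [|r rE] := @linear_lift _ _ _ _ a (idfun \- (s \o b) : {linear B -> B}) ai.
  by move=> y; apply/ex; rewrite /= linearB /= sE subrr.
have ba0 x : b (a x) = 0 by apply/ex; exists x.
by exists r => x; apply: ai; rewrite rE /= ba0 linear0 subr0.
Qed.

Lemma projective_ext1_null P N : projective P -> ext1_null P N.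
Proof.
move=> pP A B a b sab f; have [r rE] := splitting pP sab.
by exists (f \o r : {linear B -> N}) => x /=; rewrite rE.
Qed.

Lemma projective_retract P Q (s : {linear P -> Q}) (r : {linear Q -> P}) :
  (forall x, r (s x) = x) -> projective Q -> projective P.
Proof.
move=> rs pQ U V g f gs.
have [h hE] := pQ U V g (f \o r : {linear Q -> V}) gs.
by exists (h \o s : {linear P -> U}) => x /=; rewrite hE /= rs.
Qed.

Lemma projective_syz P : projective P -> projective (ker_mod (free_cover P)).
Proof.
move=> pP; have [r rE] := splitting pP (syz_ses P).
exact: projective_retract rE (@free_projective _ _).
Qed.

Lemma projective_prod P Q :
  projective P -> projective Q -> projective (P * Q)%type.
Proof.
move=> pP pQ U V g f gs.
have lP : linear (fun x : P => f (x, 0)).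
  move=> c x y; rewrite -linearP; congr (f _); congr pair => /=.
  by rewrite scaler0 addr0.
have lQ : linear (fun x : Q => f (0, x)).
  move=> c x y; rewrite -linearP; congr (f _); congr pair => /=.
  by rewrite scaler0 addr0.
have [fP fPE] := linear_of_fun lP; have [fQ fQE] := linear_of_fun lQ.
have [hP hPE] := pP U V g fP gs; have [hQ hQE] := pQ U V g fQ gs.
have lh : linear (fun x : P * Q => hP x.1 + hQ x.2).
  by move=> c [x1 x2] [y1 y2] /=; rewrite !linearP /= scalerDr addrACA.
have [h hE] := linear_of_fun lh.
exists h => -[x y]; rewrite hE /= linearD hPE hQE fPE fQE -linearD.
by congr (f _); congr pair; rewrite /= ?addr0 ?add0r.
Qed.

(** The difference [f - g p'] kills [A'], the kernel of [p]. A map on the pullback is thus corrected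
    by one coming from [B'] until it descends to [B]. *)
Lemma pullback_desc A' Y B B' N (i' : {linear A' -> Y}) (p : {linear Y -> B})
    (p' : {linear Y -> B'}) (a' : {linear A' -> B'}) (f : {linear Y -> N})
    (g : {linear B' -> N}) :
  ses i' p -> (forall x, p' (i' x) = a' x) ->
  (forall x, g (a' x) = f (i' x)) ->
  exists h : {linear B -> N}, forall y, h (p y) = f y - g (p' y).
Proof.
move=> [_ ps ex] p'i' ga'.
apply: (@linear_desc _ _ _ _ p (f \- (g \o p') : {linear Y -> N}) ps) => y.
by move=> /ex [x <-] /=; rewrite p'i' ga' subrr.
Qed.

(** Extend [f] along [i] to the pullback, which [ext1_null B' N] allows, then subtract a map pulled
    back from [B'] so that the rest descends to [B]. *)
Lemma extends_transfer A B A' B' Q N (a : {linear A -> B}) (b : {linear B -> Q})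
    (a' : {linear A' -> B'}) (b' : {linear B' -> Q}) :
  ses a b -> ses a' b' -> ext1_null B' N -> extends a' N -> extends a N.
Proof.
move=> sab sab' B'0 ea' f.
have [Y [p [p' [i [i' [sip' si'p pi p'i' _]]]]]] := pullback_ses sab sab'.
have [g gE] := B'0 _ _ _ _ sip' f.
have [h hE] := ea' (g \o i' : {linear A' -> N}).
have [k kE] := pullback_desc si'p p'i' hE.
by exists k => x; rewrite -pi kE gE (ses0 _ sip') linear0 subr0.
Qed.

(** Both cokernels are quotients of Hom(Y, N), for the pullback [Y], by the same submodule: the maps
    that are a sum of one factoring through [p] and one factoring through [p']. *)
Lemma coker_precomp_iso A B A' B' Q N (a : {linear A -> B})
    (b : {linear B -> Q}) (a' : {linear A' -> B'}) (b' : {linear B' -> Q}) :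
  ses a b -> ses a' b' -> ext1_null B N -> ext1_null B' N ->
  lmod_iso (coker_mod (precomp N a)) (coker_mod (precomp N a')).
Proof.
move=> sab sab' B0 B'0.
have [Y [p [p' [i [i' [sip' si'p pi p'i' _]]]]]] := pullback_ses sab sab'.
pose r : {linear Defs.Hom Y N -> coker_mod (precomp N a)} :=
  quotmod_pi _ \o precomp N i.
pose r' : {linear Defs.Hom Y N -> coker_mod (precomp N a')} :=
  quotmod_pi _ \o precomp N i'.
apply: (@lmod_iso_covers _ _ _ _ r r').
- move=> x; have [y <-] := quotmod_pi_surj x.
  have /extendsP/(_ y) [z <-] : extends i N by exact: B'0 sip'.
  by exists z.
- move=> x; have [y <-] := quotmod_pi_surj x.
  have /extendsP/(_ y) [z <-] : extends i' N by exact: B0 si'p.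
  by exists z.
move=> f; rewrite /r /r' /= !coker_pi0; split=> -[g gE].
- have [|h hE] := @pullback_desc _ _ _ _ N i p' p a
    (hom_fun f : {linear Y -> N}) (hom_fun g : {linear B -> N}) sip' pi.
    by move=> x; rewrite -[LHS]/(hom_fun (precomp N a g) x) gE.
  exists (to_hom (linearP h)); apply: homP => x /=.
  by rewrite -p'i' hE (ses0 _ si'p) linear0 subr0.
- have [|h hE] := @pullback_desc _ _ _ _ N i' p p' a'
    (hom_fun f : {linear Y -> N}) (hom_fun g : {linear B' -> N}) si'p p'i'.
    by move=> x; rewrite -[LHS]/(hom_fun (precomp N a' g) x) gE.
  exists (to_hom (linearP h)); apply: homP => x /=.
  by rewrite -pi hE (ses0 _ sip') linear0 subr0.
Qed.

(** [K] is the cokernel of [d'], so cocycles are the maps factoring through [c]; among them the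
    coboundaries are those whose factor extends along [k]. *)
Lemma homology_precomp_iso U V W K N (d' : {linear U -> V})
    (d : {linear V -> W}) (c : {linear V -> K}) (k : {linear K -> W}) :
  surj c -> exact_at d' c -> (forall x, d x = k (c x)) ->
  lmod_iso (homology (precomp N d) (precomp N d')) (coker_mod (precomp N k)).
Proof.
move=> cs ex dE.
have cyc (f : Defs.Hom K N) : precomp N c f \in ker_pred (precomp N d').
  apply/eqP/homP => x; change (hom_fun f (c (d' x)) = 0).
  by rewrite (_ : c _ = 0) ?linear0 //; apply/ex; exists x.
have lq : linear (fun f => Submod (cyc f) : ker_mod (precomp N d')).
  by move=> a f g; apply: val_inj; rewrite /= linearP.
have [q qE] := linear_of_fun lq.
pose Q : {linear Defs.Hom K N -> homology (precomp N d) (precomp N d')} :=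
  quotmod_pi _ \o q.
apply: (@lmod_iso_covers _ _ _ _ Q (quotmod_pi _)) => [x||f].
- have [[y yk] <-] := quotmod_pi_surj x.
  have [|f fE] := @linear_desc _ _ _ N c (hom_fun y : {linear _ -> N}) cs.
    move=> z /ex [w <-].
    by have /eqP/(congr1 (fun h => hom_fun h w)) := yk.
  exists (to_hom (linearP f)); rewrite /Q /= qE; congr quotmod_pi.
  by apply: val_inj; apply: homP => z /=; rewrite fE.
- exact: quotmod_pi_surj.
rewrite /Q /= quotmod_pi0 coker_pi0 qE; split=> [/asboolP [h hE]|[h hE]].
- exists h; apply: homP => x; have [z <-] := cs x.
  by have /(congr1 (fun h => hom_fun h z)) /= := hE; rewrite dE.
- apply/asboolP; exists h; apply: homP => z.
  by have /(congr1 (fun h => hom_fun h (c z))) /= := hE; rewrite -dE.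
Qed.

Lemma Ext_coker Q N j :
  lmod_iso (Ext Q N j.+1) (coker_mod (precomp N (syz_incl (syzygy Q j)))).
Proof.
exact: (@homology_precomp_iso _ _ _ _ N (std_diff Q j.+1) (std_diff Q j)
  (free_cover (syzygy Q j.+1)) (syz_incl (syzygy Q j)) (@free_cover_surj _ _)
  (@std_diff_im _ Q j.+1) (fun=> erefl)).
Qed.

Lemma Ext1_coker Q N :
  lmod_iso (Ext Q N 1) (coker_mod (precomp N (syz_incl Q))).
Proof. exact: Ext_coker Q N 0. Qed.

Lemma Ext_syz Q N j :
  lmod_iso (Ext Q N j.+2) (Ext (ker_mod (free_cover Q)) N j.+1).
Proof.
(* The recursion unfolds from the other end, so for a variable [j] the two sides are equal only by
   induction. *)
have E : syzygy Q j.+1 = syzygy (ker_mod (free_cover Q)) j.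
  by elim: j => //= j ->.
apply: lmod_iso_trans (Ext_coker Q N j.+1) _; rewrite E.
exact/lmod_iso_sym/Ext_coker.
Qed.

Lemma is_zero_coker U V (f : {linear U -> V}) :
  is_zero (coker_mod f) <-> surj f.
Proof.
split=> [z0 y|fs x]; first exact/coker_pi0/z0.
by have [y <-] := quotmod_pi_surj x; apply/coker_pi0; exact: fs.
Qed.

Lemma Ext1_null Q N : is_zero (Ext Q N 1) <-> ext1_null Q N.
Proof.
rewrite (is_zero_iso (Ext1_coker Q N)) is_zero_coker -extendsP.
split=> [ex A B a b sab|]; last by apply; exact: syz_ses.
apply: (extends_transfer sab (syz_ses Q)) ex.
exact/projective_ext1_null/free_projective.
Qed.

Lemma Ext1_coker_ses A B Q N (a : {linear A -> B}) (b : {linear B -> Q}) :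
  ses a b -> ext1_null B N -> lmod_iso (Ext Q N 1) (coker_mod (precomp N a)).
Proof.
move=> sab B0; apply: lmod_iso_trans (Ext1_coker Q N) _.
apply: (coker_precomp_iso (syz_ses Q) sab) B0.
exact/projective_ext1_null/free_projective.
Qed.

Lemma ext1_null_ses A B Q N (a : {linear A -> B}) (b : {linear B -> Q}) :
  ses a b -> ext1_null B N -> is_zero (Ext Q N 1) <-> extends a N.
Proof.
move=> sab B0.
by rewrite (is_zero_iso (Ext1_coker_ses sab B0)) is_zero_coker extendsP.
Qed.

Lemma projective_acyclic P N : projective P -> acyclic N P.
Proof.
move=> pP j; elim: j P pP => [|j IH] P pP.
  exact/Ext1_null/projective_ext1_null.
exact/(is_zero_iso (Ext_syz P N j))/IH/projective_syz.
Qed.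

Lemma acyclic_ext1_null N Q : acyclic N Q -> ext1_null Q N.
Proof. by move=> /(_ 0) /Ext1_null. Qed.

Lemma acyclic_syz N Q : acyclic N Q -> acyclic N (ker_mod (free_cover Q)).
Proof. by move=> Q0 j; apply/(is_zero_iso (Ext_syz Q N j)). Qed.

(** The cover [q] is [a q1] on [P1] and a lift of [q2] through [b] on [P2]. What later arguments
    need is the row of kernels [u], [v] and how it sits in [P1 * P2]. *)
Lemma horseshoe A Y B (a : {linear A -> Y}) (b : {linear Y -> B})
    K1 P1 (k1 : {linear K1 -> P1}) (q1 : {linear P1 -> A})
    K2 P2 (k2 : {linear K2 -> P2}) (q2 : {linear P2 -> B}) :
  ses a b -> ses k1 q1 -> ses k2 q2 -> projective P2 ->
  exists (K : lmodType R) (k : {linear K -> (P1 * P2)%type})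
    (q : {linear (P1 * P2)%type -> Y})
    (u : {linear K1 -> K}) (v : {linear K -> K2}),
    [/\ ses k q, ses u v, forall x, k (u x) = (k1 x, 0) &
        forall z, (k z).2 = k2 (v z)].
Proof.
move=> sab s1 s2 pP2; have [ai bs ex] := sab.
have [k1i q1s ex1] := s1; have [k2i q2s ex2] := s2.
have [l lE] := pP2 _ _ b q2 bs.
have lq : linear (fun x : P1 * P2 => a (q1 x.1) + l x.2).
  by move=> c [x1 x2] [y1 y2] /=; rewrite !linearP /= scalerDr addrACA.
have [q qE] := linear_of_fun lq.
have qs : surj q.
  move=> y; have [x2 x2E] := q2s (b y).
  have [|x xE] := (ex (y - l x2)).1; first by rewrite linearB lE x2E subrr.
  have [x1 x1E] := q1s x.
  by exists (x1, x2); rewrite qE /= x1E xE subrK.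
have [K [k skq]] : exists (K : lmodType R)
    (k : {linear K -> (P1 * P2)%type}), ses k q.
  by exists (ker_mod q), val; exact: ker_ses.
have [ki _ exk] := skq.
have lu1 : linear (fun x : K1 => (k1 x, 0 : P2)).
  by move=> c x y; congr pair; rewrite /= ?linearP // scaler0 addr0.
have [u1 u1E] := linear_of_fun lu1.
have [|u uE] := linear_lift (g := u1) ki.
  by move=> x; apply/exk; rewrite u1E qE /= (ses0 x s1) !linear0 addr0.
have lv1 : linear (fun z : K => (k z).2) by move=> c x y; rewrite linearP.
have [v1 v1E] := linear_of_fun lv1.
have [|v vE] := linear_lift (g := v1) k2i.
  move=> z; apply/ex2; rewrite v1E -lE; have := ses0 z skq.
  by rewrite qE => /(congr1 b); rewrite linearD (ses0 _ sab) add0r linear0.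
exists K, k, q, u, v; split=> // [|x|z]; last 2 first.
- by rewrite uE u1E.
- by rewrite vE v1E.
split=> [x y|x|z].
- by move=> /(congr1 k); rewrite !uE !u1E => -[/k1i].
- have [|y yE] := (ex (l (k2 x))).1; first by rewrite lE (ses0 _ s2).
  have [x1 x1E] := q1s y.
  have [|z zE] := (exk (- x1, k2 x)).1.
    by rewrite qE /= linearN x1E linearN yE addNr.
  by exists z; apply: k2i; rewrite vE v1E zE.
split=> [v0|[x <-]]; last by apply: k2i; rewrite vE v1E uE u1E linear0.
have kz2 : (k z).2 = 0 by rewrite -v1E -vE v0 linear0.
have [|x xE] := (ex1 (k z).1).1.
  apply: ai; have := ses0 z skq.
  by rewrite qE kz2 !linear0 addr0.
by exists x; apply: ki; rewrite uE u1E xE -kz2 -surjective_pairing.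
Qed.

(** Restriction along [u] is onto because Ext^1(K2, N) = 0. If the restriction of [f] extends to
    [P1], then [f] minus that extension factors through [v], and the factor extends to [P2] because
    Ext^1(B, N) = 0. *)
Lemma coker_horseshoe_iso B K1 P1 K2 P2 K N (k1 : {linear K1 -> P1})
    (k2 : {linear K2 -> P2}) (q2 : {linear P2 -> B})
    (k : {linear K -> (P1 * P2)%type}) (u : {linear K1 -> K})
    (v : {linear K -> K2}) :
  ses k2 q2 -> ses u v -> (forall x, k (u x) = (k1 x, 0)) ->
  (forall z, (k z).2 = k2 (v z)) -> ext1_null B N -> ext1_null K2 N ->
  lmod_iso (coker_mod (precomp N k)) (coker_mod (precomp N k1)).
Proof.
move=> s2 suv ku kv B0 K20.
pose r : {linear Defs.Hom K N -> coker_mod (precomp N k1)} :=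
  quotmod_pi _ \o precomp N u.
apply: (@lmod_iso_covers _ _ _ _ (quotmod_pi _) r).
- exact: quotmod_pi_surj.
- move=> x; have [y <-] := quotmod_pi_surj x.
  have /extendsP/(_ y) [z <-] : extends u N by exact: K20 suv.
  by exists z.
move=> f; rewrite /r /= !coker_pi0; split=> -[g gE].
- have lh : linear (fun x : P1 => hom_fun g (x, 0)).
    move=> c x y; rewrite -linearP; congr (hom_fun _ _); congr pair => /=.
    by rewrite scaler0 addr0.
  exists (to_hom lh); apply: homP => x /=.
  by rewrite -gE /= ku.
have lg : linear (fun z : K => hom_fun f z - hom_fun g (k z).1).
  by move=> c x y; rewrite (linearP k) /= !linearP /= scalerBr scalerN addrACA.
have [g' g'E] := linear_of_fun lg.
have [_ vs vex] := suv.
have [|h hE] := @linear_desc _ _ _ N v g' vs.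
  move=> z /vex [x <-]; rewrite g'E ku /=.
  have /(congr1 (fun h => hom_fun h x)) /= -> := gE.
  by rewrite subrr.
have [h' h'E] := B0 _ _ _ _ s2 h.
have lw : linear (fun x : P1 * P2 => hom_fun g x.1 + h' x.2).
  by move=> c [x1 x2] [y1 y2] /=; rewrite !linearP /= scalerDr addrACA.
exists (to_hom lw); apply: homP => z /=.
by rewrite kv h'E hE g'E addrC subrK.
Qed.

(** The pullback of [b] and the free cover of [Q] contains [A] with free quotient and the syzygy of
    [Q] with quotient [B]. Both quotients are acyclic, so two uses of the hypothesis replace a long
    exact sequence. *)
Lemma Ext_shift_aux N i :
  (forall A Y B (a : {linear A -> Y}) (b : {linear Y -> B}),
     ses a b -> acyclic N B -> lmod_iso (Ext Y N i.+1) (Ext A N i.+1)) ->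
  forall A B Q (a : {linear A -> B}) (b : {linear B -> Q}),
    ses a b -> acyclic N B -> lmod_iso (Ext Q N i.+2) (Ext A N i.+1).
Proof.
move=> L A B Q a b sab B0; apply: lmod_iso_trans (Ext_syz Q N i) _.
have [Y [p [p' [s [s' [sp' s'p _ _ _]]]]]] := pullback_ses sab (syz_ses Q).
apply: lmod_iso_trans (L _ _ _ _ _ sp' _); last first.
  exact/projective_acyclic/free_projective.
exact/lmod_iso_sym/(L _ _ _ _ _ s'p).
Qed.

(* Degree [i] gives [Ext_shift] in degree [i], which for the rows of the
   horseshoe raises the degree by one. *)
Lemma Ext_sub_iso N i A Y B (a : {linear A -> Y}) (b : {linear Y -> B}) :
  ses a b -> acyclic N B -> lmod_iso (Ext Y N i.+1) (Ext A N i.+1).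
Proof.
elim: i A Y B a b => [|i IH] A Y B a b sab B0.
  have [K [k [q [u [v [skq suv ku kv]]]]]] :=
    horseshoe sab (syz_ses A) (syz_ses B) (@free_projective R B).
  have pP := projective_prod (@free_projective R A) (@free_projective R B).
  apply: lmod_iso_trans (Ext1_coker_ses skq (projective_ext1_null pP)) _.
  apply: lmod_iso_trans _ (lmod_iso_sym (Ext1_coker A N)).
  apply: (coker_horseshoe_iso (syz_ses B) suv ku kv (acyclic_ext1_null B0)).
  exact/acyclic_ext1_null/acyclic_syz.
have [K [k [q [u [v [skq suv ku kv]]]]]] :=
  horseshoe sab (syz_ses A) (syz_ses B) (@free_projective R B).
have pP := projective_prod (@free_projective R A) (@free_projective R B).
apply: lmod_iso_trans (Ext_shift_aux IH skq (projective_acyclic pP)) _.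
apply: lmod_iso_trans _ (lmod_iso_sym (Ext_syz A N i)).
exact: IH suv (acyclic_syz B0).
Qed.

Lemma Ext_shift N i A B Q (a : {linear A -> B}) (b : {linear B -> Q}) :
  ses a b -> acyclic N B -> lmod_iso (Ext Q N i.+2) (Ext A N i.+1).
Proof. exact: Ext_shift_aux (@Ext_sub_iso N i) _ _ _ _ _. Qed.

End ExtSequences.

(** * Modules that are reflexive with acyclic dual *)

Section Acyclic.
Variable R : comPzRingType.
Implicit Types A B C K M N P Q T U V X Y E : lmodType R.

Lemma Ext0_null M N :
  is_zero (Ext M N 0) <-> forall (f : {linear M -> N}) x, f x = 0.
Proof.
rewrite is_zero_homology; split=> [H f x|H h dh].
  have [|z zE] := H (to_hom (linearP (f \o free_cover M : {linear _ -> N}))).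
    apply: homP => y /=; rewrite (_ : free_cover M _ = 0) ?linear0 //.
    by apply/(@std_diff_im _ M 0); exists y.
  have [y <-] := free_cover_surj x.
  by have /(congr1 (fun h => hom_fun h y)) /= := esym zE.
exists 0; rewrite /=; apply: homP => y.
have [|f fE] := @linear_desc _ _ _ N (free_cover M)
    (hom_fun h : {linear _ -> N}) (@free_cover_surj _ M).
  move=> z /(@std_diff_im _ M 0) [w <-].
  by have /(congr1 (fun h => hom_fun h w)) := dh.
by rewrite -[RHS]fE H.
Qed.

Lemma acyclic_zero N Q : is_zero Q -> acyclic N Q.
Proof.
move=> Q0; apply: projective_acyclic => U V g f _.
by exists \0 => x /=; rewrite linear0 (Q0 x) linear0.
Qed.

(** In positive degrees an isomorphism is a short exact sequence with zero cokernel, and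
    [Ext_sub_iso] applies; degree 0 is read off from Hom. *)
Lemma Ext_iso U V N i :
  lmod_iso U V -> is_zero (Ext U N i) <-> is_zero (Ext V N i).
Proof.
move=> UV; case: i => [|i].
  have H W W' : lmod_iso W W' -> is_zero (Ext W N 0) -> is_zero (Ext W' N 0).
    move=> [g _ gs] /Ext0_null W0; apply/Ext0_null => f x.
    by have [y <-] := gs x; exact: (W0 (f \o g : {linear W -> N})).
  by split; apply: H => //; exact: lmod_iso_sym.
have [f fi fs] := UV.
apply: iff_sym; apply: is_zero_iso; apply: (Ext_sub_iso i (ses_coker fi)).
exact/acyclic_zero/is_zero_coker.
Qed.

Lemma acyclic_iso U V N : lmod_iso U V -> acyclic N U -> acyclic N V.
Proof. by move=> UV U0 j; apply/(Ext_iso N j.+1 UV). Qed.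

(** The complementary summand [K] is again a retract of [Q], and a dimension shift trades degree
    [j.+2] of [P] for degree [j.+1] of [K]; hence the induction generalizes over the summand. *)
Lemma acyclic_retract N P Q (s : {linear P -> Q}) (r : {linear Q -> P}) :
  (forall x, r (s x) = x) -> acyclic N Q -> acyclic N P.
Proof.
move=> rs Q0 j; elim: j P s r rs => [|j IH] P s r rs.
all: have sr : surj r by (move=> x; exists (s x)).
all: have [K [k skr]] : exists (K : lmodType R) (k : {linear K -> Q}), ses k r
  by (exists (ker_mod r), val; exact: ker_ses).
all: have [ki _ kex] := skr.
all: have [|t tE] :=
  linear_lift (g := idfun \- (s \o r) : {linear Q -> Q}) ki;
  first by move=> y; apply/kex; rewrite /= linearB /= rs subrr.
all: have tk x : t (k x) = x
  by apply: ki; rewrite tE /= (ses0 x skr) linear0 subr0.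
- apply/(ext1_null_ses skr (acyclic_ext1_null Q0)) => f.
  by exists (f \o t : {linear Q -> N}) => x /=; rewrite tk.
- exact/(is_zero_iso (Ext_shift j skr Q0))/(IH K k t tk).
Qed.

(** [I] is the image of [b], taken as the kernel of [c]. *)
Lemma two_step_ses A B B' T (a : {linear A -> B}) (b : {linear B -> B'})
    (c : {linear B' -> T}) :
  injective a -> exact_at a b -> exact_at b c -> surj c ->
  exists (I : lmodType R) (g : {linear B -> I}) (k : {linear I -> B'}),
    [/\ ses a g, ses k c & forall x, k (g x) = b x].
Proof.
move=> ai exb exc cs.
have skc := ker_ses cs; have [ki _ exk] := skc.
have [|g gE] := linear_lift (g := b) ki.
  by move=> x; apply/exk/exc; exists x.
exists (ker_mod c), g, val; split=> //; split=> // [z|x].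
  have /exc [x xE] := (exk (val z)).2 (ex_intro _ z erefl).
  by exists x; apply: ki; rewrite gE.
rewrite -exb -gE; split=> [->|gx0]; first by rewrite linear0.
by apply: ki; rewrite gx0 linear0.
Qed.

Section Reflexive.
Variable C : lmodType R.

Definition reflexive_acyclic Y : Prop :=
  bijective (@biduality R C Y) /\ acyclic C (Defs.Hom Y C).

(** Vanishing of H^i(K) for the augmented complex K, spelled out degree by degree. The kernel and
    cokernel of biduality occupy degrees 0 and 1, which puts Ext^(j+1) in degree [j.+2]. *)
Definition bidual_null M (i : nat) : Prop :=
  match i with
  | 0 => injective (@biduality R C M)
  | 1 => surj (@biduality R C M)
  | j.+2 => is_zero (Ext (Defs.Hom M C) C j.+1)
  end.

Lemma biduality_inj0 Y :
  injective (@biduality R C Y) <->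
  forall y : Y, (forall h : {linear Y -> C}, h y = 0) -> y = 0.
Proof.
split=> [bi y hy|H].
  by apply: bi; rewrite linear0; apply: homP => h; exact: hy.
apply: linear_inj0 => y by0; apply: H => h.
by have /(congr1 (fun f => hom_fun f (to_hom (linearP h)))) := by0.
Qed.

Lemma biduality_sep Y (x y : Y) : injective (@biduality R C Y) ->
  (forall h : {linear Y -> C}, h x = h y) -> x = y.
Proof.
move=> bi hxy; apply/eqP; rewrite -subr_eq0; apply/eqP.
by apply: (biduality_inj0 Y).1 bi _ _ => h; rewrite linearB hxy subrr.
Qed.

Lemma biduality_surj Y :
  surj (@biduality R C Y) <->
  forall u : {linear Defs.Hom Y C -> C}, exists y, forall h, u h = hom_fun h y.
Proof.
split=> [bs u|H u].
  have [y yE] := bs (to_hom (linearP u)); exists y => h.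
  by have /(congr1 (fun f => hom_fun f h)) := esym yE.
have [y yE] := H (hom_fun u : {linear _ -> C}).
by exists y; apply: homP => h; exact/esym/yE.
Qed.

Lemma reflexive_acyclicP Y : reflexive_acyclic Y <->
  [/\ injective (@biduality R C Y), surj (@biduality R C Y) &
      acyclic C (Defs.Hom Y C)].
Proof.
split=> [[[g gK Kg] ac]|[bi bs ac]].
  by split=> // [|y]; [exact: can_inj gK|exists (g y)].
have [g gE] := choice bs.
by split=> //; exists g => // y; apply: bi; rewrite gE.
Qed.

Lemma reflexive_retract P Q (s : {linear P -> Q}) (r : {linear Q -> P}) :
  (forall x, r (s x) = x) -> reflexive_acyclic Q -> reflexive_acyclic P.
Proof.
move=> rs /reflexive_acyclicP [/biduality_inj0 bi /biduality_surj bs ac].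
apply/reflexive_acyclicP; split.
- apply/biduality_inj0 => x hx; rewrite -[x]rs (bi (s x)) ?linear0 // => h.
  exact: (hx (h \o s : {linear P -> C})).
- apply/biduality_surj => u.
  have [q qE] := bs (u \o precomp C s : {linear _ -> C}).
  exists (r q) => h; have /= := qE (precomp C r h).
  by move=> <-; congr (u _); apply: homP => x /=; rewrite rs.
apply: (acyclic_retract (s := precomp C r) (r := precomp C s)) ac => h.
by apply: homP => x /=; rewrite rs.
Qed.

Lemma precomp_left_exact A B Q (a : {linear A -> B}) (b : {linear B -> Q}) :
  exact_at a b -> surj b ->
  injective (precomp C b) /\ exact_at (precomp C b) (precomp C a).
Proof.
move=> ex bs; split=> [g h gh|h].
  apply: homP => x; have [y <-] := bs x.
  by have := congr1 (fun f => hom_fun f y) gh.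
split=> [h0|[g <-]]; last first.
  apply: homP => x /=; rewrite (_ : b _ = 0) ?linear0 //.
  by apply/ex; exists x.
have [|g gE] := @linear_desc _ _ _ C b (hom_fun h : {linear B -> C}) bs.
  move=> y /ex [x <-].
  by have /(congr1 (fun f => hom_fun f x)) := h0.
by exists (to_hom (linearP g)); apply: homP => x; exact: gE.
Qed.

Lemma precomp_ses A B Q (a : {linear A -> B}) (b : {linear B -> Q}) :
  ses a b -> extends a C -> ses (precomp C b) (precomp C a).
Proof. by move=> [_ bs ex] /extendsP ea; have [] := precomp_left_exact ex bs. Qed.

Lemma reflexive_prod P Q :
  reflexive_acyclic P -> reflexive_acyclic Q ->
  reflexive_acyclic (P * Q)%type.
Proof.
move=> /reflexive_acyclicP [/biduality_inj0 bi /biduality_surj bs ac].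
move=> /reflexive_acyclicP [/biduality_inj0 bi' /biduality_surj bs' ac'].
have l1 : linear (fun x : P => (x, 0 : Q)).
  by move=> c x y; congr pair; rewrite /= scaler0 addr0.
have l2 : linear (fun x : Q => (0 : P, x)).
  by move=> c x y; congr pair; rewrite /= scaler0 addr0.
have lp1 : linear (fun x : P * Q => x.1) by [].
have lp2 : linear (fun x : P * Q => x.2) by [].
have [i1 i1E] := linear_of_fun l1; have [i2 i2E] := linear_of_fun l2.
have [p1 p1E] := linear_of_fun lp1; have [p2 p2E] := linear_of_fun lp2.
have sum x : i1 (p1 x) + i2 (p2 x) = x.
  rewrite i1E i2E p1E p2E; case: x => x y.
  by congr pair; rewrite /= ?addr0 ?add0r.
apply/reflexive_acyclicP; split.
- apply/biduality_inj0 => x hx.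
  have x1 : p1 x = 0.
    by apply: bi => h; exact: (hx (h \o p1 : {linear (P * Q)%type -> C})).
  have x2 : p2 x = 0.
    by apply: bi' => h; exact: (hx (h \o p2 : {linear (P * Q)%type -> C})).
  by rewrite -[x]sum x1 x2 !linear0 addr0.
- apply/biduality_surj => u.
  have [x xE] := bs (u \o precomp C p1 : {linear _ -> C}).
  have [y yE] := bs' (u \o precomp C p2 : {linear _ -> C}).
  exists (i1 x + i2 y) => h.
  transitivity (hom_fun h (i1 x) + hom_fun h (i2 y)).
    have /= <- := xE (precomp C i1 h); have /= <- := yE (precomp C i2 h).
    rewrite -(linearD u); congr (u _).
    apply: homP => z; rewrite -[RHS]/(hom_fun h _ + hom_fun h _) /=.
    by rewrite -(linearD (hom_fun h)) sum.
  by rewrite -(linearD (hom_fun h)).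
have s1 : ses i2 p1.
  split=> [x y||z]; first by rewrite !i2E => -[].
    by move=> x; exists (x, 0); rewrite p1E.
  split=> [z1|[x <-]]; last by rewrite i2E p1E.
  by exists (p2 z); rewrite -[RHS]sum z1 linear0 add0r.
have e2 : extends i2 C.
  by move=> f; exists (f \o p2 : {linear _ -> C}) => x /=; rewrite i2E p2E.
move=> j; apply/(is_zero_iso (Ext_sub_iso j (precomp_ses s1 e2) ac')).
exact: ac.
Qed.

End Reflexive.
End Acyclic.

(** * Ext of the transpose and of Ext(M, C) *)

Section Transpose.
Variables (R : comPzRingType) (C : lmodType R).
Implicit Types A B K M N P Q T U V X Y E : lmodType R.

(** Functionals on the dual of [X] are evaluations at points [x]; restricted along [precomp C e]
    they become evaluations at [e x]. *)
Lemma extends_precomp_reflexive X M (e : {linear X -> M}) :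
  surj e -> reflexive_acyclic C X ->
  extends (precomp C e) C <-> surj (@biduality R C M).
Proof.
move=> es /reflexive_acyclicP [_ /biduality_surj bs _].
rewrite biduality_surj; split=> H u.
  have [v vE] := H u; have [x xE] := bs v.
  by exists (e x) => h; rewrite -vE xE.
have [m mE] := H u; have [x xm] := es m.
exists (hom_fun (@biduality R C X x) : {linear Defs.Hom X C -> C}) => h.
by rewrite mE -xm.
Qed.

(** The dual sequence splits at the image [I] of [precomp C f]. Ext^1 of the transpose is the
    obstruction to extending functionals from [I]; one shift leads to Ext^1(I, C), and two shifts
    lead to Ext of the dual of [M]. *)
Lemma Ext_Tr Y1 Y0 M (f : {linear Y1 -> Y0}) (e : {linear Y0 -> M}) i :
  exact_at f e -> surj e -> reflexive_acyclic C Y1 -> reflexive_acyclic C Y0 ->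
  is_zero (Ext (Tr C f) C i.+1) <-> bidual_null C M i.
Proof.
move=> ex es r1 r0.
have [_ /biduality_surj bs1 ac1] := (reflexive_acyclicP C Y1).1 r1.
have [bi0 /biduality_surj bs0 ac0] := (reflexive_acyclicP C Y0).1 r0.
have [ei exb] := precomp_left_exact C ex es.
have exc : exact_at (precomp C f) (quotmod_pi (im_pred (precomp C f))).
  exact: coker_pi0.
have [I [g [k [sg sk kg]]]] := two_step_ses ei exb exc (@quotmod_pi_surj _ _ _).
have eI := ext1_null_ses sk (acyclic_ext1_null ac1).
case: i => [|[|i]].
- rewrite eI /bidual_null biduality_inj0; split=> [ext x hx|bi u].
    (* Evaluation at a lift [y] kills the dual of [M], so it descends to [I]. Extended to the dual
       of [Y1] it is evaluation at some [z], which forces [y = f z] and [x = 0]. *)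
    have [y yx] := es x.
    have [|w wE] := @linear_desc _ _ _ C g
        (hom_fun (@biduality R C Y0 y) : {linear _ -> C}) (let: And3 _ s _ := sg in s).
      have [_ _ exg] := sg => h /exg [m <-] /=; rewrite yx.
      exact: (hx (hom_fun m : {linear _ -> C})).
    have [v vE] := ext w; have [z zE] := bs1 v.
    rewrite -yx; apply/ex; exists z.
    apply: (biduality_sep bi0) => h.
    rewrite -[LHS]/(hom_fun (precomp C f (to_hom (linearP h))) z) -zE -kg vE wE.
    by [].
  have [y yE] := bs0 (u \o g : {linear _ -> C}).
  have ey : e y = 0.
    apply: bi => h; have := yE (precomp C e (to_hom (linearP h))).
    by rewrite /= (ses0 _ sg) linear0 => <-.
  have [z zy] := (ex y).1 ey.
  exists (hom_fun (@biduality R C Y1 z) : {linear _ -> C}) => x.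
  have [_ gs _] := sg; have [h <-] := gs x; rewrite kg /= zy.
  exact/esym/yE.
- rewrite (is_zero_iso (Ext_shift 0 sk ac1)).
  rewrite (ext1_null_ses sg (acyclic_ext1_null ac0)).
  exact: extends_precomp_reflexive.
- rewrite (is_zero_iso (Ext_shift i.+1 sk ac1)).
  exact/is_zero_iso/(Ext_shift i sg ac0).
Qed.

(** A functional on the cokernel is evaluation at some [y] in [Y1], and [f y] is then killed by all
    functionals on [Y0]. *)
Lemma Hom_Tr_inj Y1 Y0 (f : {linear Y1 -> Y0}) :
  injective f -> reflexive_acyclic C Y1 -> reflexive_acyclic C Y0 ->
  is_zero (Ext (Tr C f) C 0).
Proof.
move=> fi /reflexive_acyclicP [_ /biduality_surj bs1 _].
move=> /reflexive_acyclicP [/biduality_inj0 bi0 _ _].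
apply/Ext0_null => u x; have [h <-] := quotmod_pi_surj x.
have [y yE] := bs1 (u \o quotmod_pi _ : {linear Defs.Hom Y1 C -> C}).
have -> : u (quotmod_pi _ h) = hom_fun h y by exact: yE.
suff -> : y = 0 by rewrite linear0.
apply: fi; rewrite linear0; apply: bi0 => g.
have /= <- := yE (precomp C f (to_hom (linearP g))).
rewrite (_ : quotmod_pi _ _ = 0) ?linear0 //.
by apply/coker_pi0; exists (to_hom (linearP g)).
Qed.

(** The complex K of a syzygy is that of [M] moved by one degree: [extends a C] makes the dual
    sequence exact, and reflexivity of [X] gives the connecting argument in degrees 0 and 1. *)
Lemma bidual_null_shift A X M (a : {linear A -> X}) (e : {linear X -> M}) i :
  ses a e -> extends a C -> reflexive_acyclic C X ->
  bidual_null C A i.+1 <-> bidual_null C M i.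
Proof.
move=> sae ea rX; have sd := precomp_ses sae ea.
have [ai es ex] := sae; have [_ ds _] := sd.
have [bi /biduality_surj bs ac] := (reflexive_acyclicP C X).1 rX.
case: i => [|[|i]].
- rewrite /bidual_null biduality_surj biduality_inj0; split=> H.
    move=> m hm; have [x xm] := es m.
    have [|u uE] := @linear_desc _ _ _ C (precomp C a)
        (hom_fun (@biduality R C X x) : {linear _ -> C}) ds.
      have [_ _ exd] := sd => h /exd [g <-] /=; rewrite xm.
      exact: (hm (hom_fun g : {linear _ -> C})).
    have [z zE] := H u; rewrite -xm; apply/ex; exists z.
    apply: (biduality_sep bi) => h.
    have := zE (precomp C a (to_hom (linearP h))).
    by rewrite uE => /= <-.
  move=> u; have [x xE] := bs (u \o precomp C a : {linear _ -> C}).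
  have ex0 : e x = 0.
    apply: H => h; have := xE (precomp C e (to_hom (linearP h))).
    by rewrite /= (ses0 _ sd) linear0 => <-.
  have [z zx] := (ex x).1 ex0; exists z => h; have [g <-] := ds h.
  by rewrite /= zx; exact: xE.
- rewrite [X in X <-> _](ext1_null_ses sd (acyclic_ext1_null ac)).
  exact: extends_precomp_reflexive.
- exact/is_zero_iso/(Ext_shift i sd ac).
Qed.

Lemma biduality_sub_inj A X (a : {linear A -> X}) :
  injective a -> injective (@biduality R C X) -> injective (@biduality R C A).
Proof.
move=> ai /biduality_inj0 bi; apply/biduality_inj0 => x hx.
apply: ai; rewrite linear0; apply: bi => h.
exact: (hx (h \o a : {linear A -> C})).
Qed.

Lemma totally_reflexive_acyclic X :
  totally_reflexive C X -> acyclic C X /\ reflexive_acyclic C X.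
Proof. by move=> [_ b ac ac']; split=> [j|]; [exact: ac|split=> // j; exact: ac']. Qed.

Lemma GC_resolution_syz M n : has_GC_resolution C M n.+1 ->
  exists (X A : lmodType R) (a : {linear A -> X}) (e : {linear X -> M}),
    [/\ ses a e, totally_reflexive C X & has_GC_resolution C A n].
Proof.
move=> [F FE]; exists (res_term F 0), (ker_mod (res_aug F)), val, (res_aug F).
have se := ker_ses (@res_surj _ _ F).
split=> //; first by case: (FE 0) => + _; apply.
have [ki _ kex] := se.
have [|d dE] := linear_lift (g := res_diff F 0) ki.
  by move=> y; apply/kex/res_exact0; exists y.
have ds : surj d.
  move=> y; have /res_exact0 [x xE] := (kex (val y)).2 (ex_intro _ y erefl).
  by exists x; apply: ki; rewrite dE.
have dex : exact_at (res_diff F 1) d.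
  move=> y; rewrite -res_exactS -dE; split=> [->|y0]; first by rewrite linear0.
  by apply: ki; rewrite y0 linear0.
exists (Resolution ds dex (fun i => @res_exactS _ _ F i.+1)) => i /=.
by have [H1 H2] := FE i.+1; split.
Qed.

Lemma GC_resolution0 M : has_GC_resolution C M 0 ->
  exists2 X : lmodType R, totally_reflexive C X & lmod_iso X M.
Proof.
move=> [F FE]; exists (res_term F 0); first by case: (FE 0) => + _; apply.
exists (res_aug F); last exact: res_surj.
apply: linear_inj0 => x /res_exact0 [y <-].
have [_ /(_ isT) z0] := FE 1.
by rewrite (z0 y) linear0.
Qed.

Lemma reflexive_acyclic_iso X M :
  lmod_iso X M -> reflexive_acyclic C X -> reflexive_acyclic C M.
Proof.
move=> [f fi fs].
have [g gE] := @linear_lift _ _ _ _ f (idfun : {linear M -> M}) fi fs.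
by apply: reflexive_retract gE.
Qed.

(** Induction on the length, passing from [M] to its first syzygy [A]. [E] is fixed only up to
    isomorphism, so that Ext(M, C) may be replaced by Ext(A, C) one degree lower. *)
Lemma Ext_Ext_GC n M E : has_GC_resolution C M n.+1 ->
  (forall j, (j < n)%N -> is_zero (Ext M C j.+1)) ->
  lmod_iso (Ext M C n.+1) E ->
  (forall j, (j < n.+1)%N -> is_zero (Ext E C j)) /\
  (forall i, is_zero (Ext E C (n.+1 + i)) <-> bidual_null C M i).
Proof.
elim: n M => [|n IH] M /GC_resolution_syz [X [A [a [e [sae tX gA]]]]] M0 ME;
  have [acX rX] := totally_reflexive_acyclic tX.
  have [X' tX' XA] := GC_resolution0 gA.
  have [_ rX'] := totally_reflexive_acyclic tX'.
  have rA := reflexive_acyclic_iso XA rX'.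
  have [ai es ex] := sae.
  (* At length one the resolution itself presents [M], and [E] is the transpose formed from [a]. *)
  have TE : lmod_iso (Tr C a) E.
    apply: lmod_iso_trans ME; apply: lmod_iso_sym.
    exact: Ext1_coker_ses sae (acyclic_ext1_null acX).
  split=> [[|//] _|i]; first exact/(Ext_iso C 0 TE)/Hom_Tr_inj.
  rewrite -(Ext_iso C _ TE); exact: (Ext_Tr i ex es rA rX).
have ea : extends a C.
  apply/(ext1_null_ses sae (acyclic_ext1_null acX)); exact: M0.
have [||E0 Ei] := IH A gA.
- by move=> j jn; apply/(is_zero_iso (Ext_shift j sae acX))/M0.
- exact: lmod_iso_trans (lmod_iso_sym (Ext_shift n sae acX)) ME.
have [ai _ _] := sae.
split=> [j|i]; last by rewrite addSnnS Ei; exact: (bidual_null_shift i sae ea rX).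
(* The only degree not covered by induction is [n.+1], where vanishing means injectivity of
   biduality for [A]; this holds since [A] embeds in the reflexive module [X]. *)
rewrite ltnS leq_eqVlt => /orP [/eqP ->|/E0 //].
rewrite -[n.+1]addn0 Ei; exact: biduality_sub_inj ai (bij_inj rX.1).
Qed.

End Transpose.

(** * Semidualizing modules *)

Section FreeSum.
Variable R : comPzRingType.

(* [R^o ^ (m + 1)], as iterated binary products. *)
Fixpoint free_sum (m : nat) : lmodType R :=
  if m is k.+1 then (R^o * free_sum k)%type else R^o.

Lemma free_sum_combination (P : lmodType R) m (g : 'I_m -> P) :
  exists q : {linear free_sum m -> P},
    forall c : 'I_m -> R, exists x, q x = \sum_i c i *: g i.
Proof.
elim: m g => [|m IH] g.
  by exists \0 => c; exists 0; rewrite big_ord0.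
have [q qE] := IH (fun i => g (lift ord0 i)).
have lp : linear (fun x : R^o * free_sum m => (x.1 : R) *: g ord0 + q x.2).
  move=> c [x1 x2] [y1 y2] /=; rewrite linearP scalerDl scalerDr scalerA.
  by rewrite addrACA.
have [p pE] := linear_of_fun lp; exists p => c.
have [x xE] := qE (fun i => c (lift ord0 i)).
by exists (c ord0, x); rewrite pE /= xE big_ord_recl.
Qed.

Lemma fin_module_cover (P : lmodType R) : fin_module P ->
  exists (m : nat) (q : {linear free_sum m -> P}), surj q.
Proof.
move=> [m [g gE]]; have [q qE] := free_sum_combination g.
by exists m, q => y; have [c ->] := gE y.
Qed.

End FreeSum.

Section Semidualizing.
Variables (R : comPzRingType) (C : lmodType R).
Hypothesis hC : semidualizing C.
Implicit Types A B M N P Q X Y E : lmodType R.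

Lemma semidualizing_faithful (a b : R) :
  (forall x : C, a *: x = b *: x) -> a = b.
Proof.
have [_ [g gK _] _] := hC => ab.
by apply: (can_inj gK); apply: homP.
Qed.

Lemma semidualizing_scalar (u : {linear C -> C}) :
  exists a : R, forall x, u x = a *: x.
Proof.
have [_ [g _ Kg] _] := hC; exists (g (to_hom (linearP u))) => x.
by have /(congr1 (fun h => hom_fun h x)) := esym (Kg (to_hom (linearP u))).
Qed.

Lemma semidualizing_acyclic : acyclic C C.
Proof. by have [_ _ H] := hC => j; exact: H. Qed.

(** Evaluation at 1 identifies Hom(R, C) with [C]. Biduality of [R^o] then becomes the homothety
    map, and acyclicity of the dual becomes that of [C]. *)
Lemma reflexive_acyclic_self : reflexive_acyclic C R^o.
Proof.
have lm (c : C) : linear (fun a : R^o => (a : R) *: c).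
  by move=> a x y; rewrite scalerDl scalerA.
have form1 (h : Defs.Hom R^o C) (b : R) :
    hom_fun h (b : R^o) = b *: hom_fun h (1 : R^o).
  by rewrite -linearZ; congr (hom_fun _ _); rewrite -[RHS]/(b * 1) mulr1.
apply/reflexive_acyclicP; split.
- apply/biduality_inj0 => a ha; apply: semidualizing_faithful => c.
  have [h hE] := linear_of_fun (lm c).
  by rewrite scale0r -[LHS](hE a) ha.
- apply/biduality_surj => u.
  have lu : linear (fun c : C => u (to_hom (lm c))).
    move=> a x y; rewrite -linearP; congr (u _); apply: homP => b.
    change ((b : R) *: (a *: x + y) = a *: ((b : R) *: x) + (b : R) *: y).
    by rewrite scalerDr !scalerA mulrC.
  have [v vE] := linear_of_fun lu; have [a aE] := semidualizing_scalar v.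
  exists a => h; rewrite form1 -aE vE; congr (u _); apply: homP => b.
  by rewrite form1.
have le : linear (fun h : Defs.Hom R^o C => hom_fun h (1 : R^o)) by [].
have [e eE] := linear_of_fun le.
apply: (acyclic_iso _ semidualizing_acyclic); apply: lmod_iso_sym; exists e.
  apply: linear_inj0 => h; rewrite eE => h1; apply: homP => b.
  by rewrite form1 h1 scaler0.
by move=> c; exists (to_hom (lm c)); rewrite eE /= scale1r.
Qed.

Lemma reflexive_acyclic_projective P :
  fin_module P -> projective P -> reflexive_acyclic C P.
Proof.
move=> /fin_module_cover [m [q qs]] pP.
have [s sE] := pP _ _ q (idfun : {linear P -> P}) qs.
apply: (reflexive_retract sE); elim: m {q qs s sE} => [|m IH] /=.
  exact: reflexive_acyclic_self.
exact: reflexive_prod reflexive_acyclic_self IH.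
Qed.

(** With [form_scalar] as converse, this is the identification of Hom(C, Hom(X, C)) with Hom(X, R),
    obtained by swapping arguments and using End(C) = R. *)
Lemma scalar_form X (u : {linear C -> Defs.Hom X C}) :
  exists w : {linear X -> R^o}, forall c x, hom_fun (u c) x = (w x : R) *: c.
Proof.
have H x : exists a : R, forall c, hom_fun (u c) x = a *: c.
  have lx : linear (fun c => hom_fun (u c) x).
    by move=> a c d; rewrite linearP.
  have [v vE] := linear_of_fun lx; have [a aE] := semidualizing_scalar v.
  by exists a => c; rewrite -vE.
have [w wE] := choice H.
have lw : linear (w : X -> R^o).
  move=> a x y; apply: semidualizing_faithful => c.
  transitivity (a *: hom_fun (u c) x + hom_fun (u c) y).
    by rewrite -wE linearP.
  by rewrite !wE scalerA -scalerDl.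
by have [w' wE'] := linear_of_fun lw; exists w' => c x; rewrite wE' wE.
Qed.

Lemma form_scalar X (w : {linear X -> R^o}) :
  exists u : {linear C -> Defs.Hom X C},
    forall c x, hom_fun (u c) x = (w x : R) *: c.
Proof.
have lc (c : C) : linear (fun x : X => (w x : R) *: c).
  by move=> a x y; rewrite linearP scalerDl -[(a *: w x : R^o)]/(a * w x) -scalerA.
have lu : linear (fun c => to_hom (lc c)).
  move=> a c d; apply: homP => x.
  change ((w x : R) *: (a *: c + d) = a *: ((w x : R) *: c) + (w x : R) *: d).
  by rewrite scalerDr !scalerA mulrC.
by have [u uE] := linear_of_fun lu; exists u => c x; rewrite uE.
Qed.

End Semidualizing.

(** * Acyclicity and exact sequences in the second variable of Ext *)

Section SecondVariable.
Variable R : comPzRingType.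
Implicit Types A B K M N P Q S X Y E : lmodType R.

Lemma ext1_null_syzygy Q N j :
  is_zero (Ext Q N j.+1) <-> ext1_null (syzygy Q j) N.
Proof.
refine (iff_trans (is_zero_iso _) (Ext1_null (syzygy Q j) N)).
exact: lmod_iso_trans (Ext_coker Q N j) (lmod_iso_sym (Ext1_coker _ N)).
Qed.

(** Lift over the free cover of [Q]; on the syzygy the lift takes values in [K], and subtracting an
    extension of that restriction makes it descend to [Q]. *)
Lemma hom_lift Q K A B (k : {linear K -> A}) (b : {linear A -> B})
    (u : {linear Q -> B}) :
  ses k b -> ext1_null Q K -> exists v : {linear Q -> A}, forall x, b (v x) = u x.
Proof.
move=> skb Q0; have [ki bs ex] := skb; have sQ := syz_ses Q.
have [l lE] := @free_projective R Q _ _ b (u \o free_cover Q : {linear _ -> B}) bs.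
have [|f fE] := linear_lift (g := l \o syz_incl Q : {linear _ -> A}) ki.
  by move=> x; apply/ex; rewrite /= lE /= (ses0 x sQ) linear0.
have [g gE] := Q0 _ _ _ _ sQ f.
have [|v vE] := @linear_desc _ _ _ A (free_cover Q)
    (l \- (k \o g) : {linear _ -> A}) (@free_cover_surj _ Q).
  have [_ _ exQ] := sQ => y /exQ [x <-].
  by rewrite /= gE fE subrr.
exists v => x; have [y <-] := free_cover_surj x.
by rewrite vE /= linearB /= lE (ses0 _ skb) subr0.
Qed.

(** A map from the syzygy of [S] to [B] lifts to [A] by Ext^1 vanishing into [K] one syzygy further,
    and the lift extends by Ext^1 vanishing of [S] into [A]. *)
Lemma acyclic_quotient Q K A B (k : {linear K -> A}) (b : {linear A -> B}) :
  ses k b -> acyclic K Q -> acyclic A Q -> acyclic B Q.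
Proof.
move=> skb Ka Aa j; apply/ext1_null_syzygy; set S := syzygy Q j.
apply/Ext1_null/(ext1_null_ses (syz_ses S)).
  exact/projective_ext1_null/free_projective.
move=> f; have /ext1_null_syzygy K1 := Ka j.+1.
have [g gE] := hom_lift f skb K1.
have /ext1_null_syzygy A1 := Aa j.
have [h hE] := A1 _ _ _ _ (syz_ses S) g.
by exists (b \o h : {linear _ -> B}) => x; rewrite /= hE gE.
Qed.

(** Swapping arguments turns the extension problem into lifting a map from [P] along the surjection
    Hom(B, N) -> Hom(A, N). *)
Lemma acyclic_Hom Q N P : projective P -> acyclic N Q -> acyclic (Defs.Hom P N) Q.
Proof.
move=> pP Na j; apply/ext1_null_syzygy => A B a b sab f.
have /ext1_null_syzygy/(_ _ _ _ _ sab)/extendsP as_ := Na j.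
have lf x : linear (fun y : A => hom_fun (f y) x).
  by move=> c y z; rewrite linearP.
have lg : linear (fun x => to_hom (lf x)).
  by move=> c x y; apply: homP => z; rewrite /= linearP.
have [g gE] := linear_of_fun lg.
have [h hE] := pP _ _ (precomp N a) g as_.
have lh y : linear (fun x : P => hom_fun (h x) y).
  by move=> c x z; rewrite linearP.
have lk : linear (fun y => to_hom (lh y)).
  by move=> c x y; apply: homP => z; rewrite /= linearP.
have [k kE] := linear_of_fun lk.
exists k => x; rewrite kE; apply: homP => p /=.
by rewrite -[LHS]/(hom_fun (precomp N a (h p)) x) hE gE.
Qed.

End SecondVariable.

(** * Grades computed with C *)

Section AssociatedPrime.
Variable R : comPzRingType.
Hypothesis hR : noetherian R.

Lemma noetherian_maximal (F : set R -> Prop) :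
  (exists I, F I) -> (forall I, F I -> is_ideal I) ->
  exists2 I, F I & forall J, F J -> (I `<=` J)%classic -> (J `<=` I)%classic.
Proof.
move=> [I0 FI0] Fid; apply: contrapT => noM.
have next (I : {I | F I}) :
    exists J : {J | F J}, (sval I `<=` sval J)%classic /\
      ~ (sval J `<=` sval I)%classic.
  case: I => I FI /=; apply: contrapT => noJ; apply: noM; exists I => // J FJ IJ.
  by apply: contrapT => JI; apply: noJ; exists (exist _ J FJ).
have [f fE] := choice next.
pose s n := iter n f (exist _ I0 FI0).
have smono m n : (m <= n)%N -> (sval (s m) `<=` sval (s n))%classic.
  move=> /subnK <-; elim: (n - m)%N => [|k IH]; first by [].
  by apply: subset_trans IH _; have [] := fE (s (k + m)%N).
have sid n := Fid _ (svalP (s n)).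
have Uid : is_ideal (fun x => exists n, sval (s n) x).
  split=> [|x y [m sx] [n sy]|a x [m sx]].
  - by exists 0; have [] := sid 0.
  - exists (maxn m n); have [_ sD _] := sid (maxn m n).
    by apply: sD; [apply: smono sx|apply: smono sy];
      rewrite ?leq_maxl ?leq_maxr.
  by exists m; have [_ _ sZ] := sid m; exact: sZ.
have [k [a aE]] := hR Uid.
have ai i : exists n, sval (s n) (a i).
  apply/aE; exists (fun j => (j == i)%:R).
  rewrite (bigD1 i) //= eqxx mul1r big1 ?addr0 // => j /negPf ->.
  by rewrite mul0r.
have [N aN] := choice ai.
(* All generators of the union lie in the term of index [\max_i N i], so the chain stops there,
   against the choice of its next term. *)
have [_] := fE (s (\max_i N i)); apply => x sx.
have /aE [c ->] : exists n, sval (s n) x by exists (\max_i N i).+1.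
have [s0 sD sZ] := sid (\max_i N i).
apply: (big_ind (sval (s (\max_i N i)))) => // i _; apply: sZ.
exact: smono (leq_bigmax i) _ (aN i).
Qed.

(** An annihilator maximal among those of nonzero elements is prime: Ann(b x) contains Ann(x), so it
    equals Ann(x) unless b x = 0. *)
Lemma associated_prime (X : lmodType R) : ~ is_zero X ->
  exists2 x : X, x <> 0 &
    forall a b : R, (a * b) *: x = 0 -> b *: x = 0 \/ a *: x = 0.
Proof.
move=> X0; have [x0 x0n] : exists x : X, x <> 0.
  by apply: contrapT => H; apply: X0 => x; apply: contrapT => xn; apply: H; exists x.
pose F (I : set R) := exists2 x : X, x <> 0 & I = (fun a => a *: x = 0).
have [||_ [x xn ->] xmax] := @noetherian_maximal F.
- by exists (fun a => a *: x0 = 0); exists x0.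
- move=> _ [x _ ->]; split=> [|a b ax bx|a b bx]; first exact: scale0r.
    by rewrite scalerDl ax bx addr0.
  by rewrite -scalerA bx scaler0.
exists x => // a b abx; have [bx|bx] := pselect (b *: x = 0); first by left.
right; apply: (xmax (fun c => c *: (b *: x) = 0)); first by exists (b *: x).
  by move=> c cx; rewrite scalerA mulrC -scalerA cx scaler0.
by rewrite scalerA.
Qed.

(* With [p = Ann x] prime, let [j] be least such that
   [C / <g_0, .., g_j>] is killed by some [s] outside [p].  Writing
   [s c = y + r g_j] with [y] in [<g_i | i < j>], the scalar [r] is determined
   modulo [p], and [c |-> r x] is the wanted map. *)
Lemma nonzero_hom (C X : lmodType R) : fin_module C ->
  (forall a : R, (forall c : C, a *: c = 0) -> a = 0) -> ~ is_zero X ->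
  exists (v : {linear C -> X}) (c : C), v c <> 0.
Proof.
move=> [m [g gE]] faith /associated_prime [x xn prime_x].
pose span (j : nat) (y : C) :=
  exists c : 'I_m -> R, y = \sum_(i < m | (i < j)%N) c i *: g i.
pose kills j (s : R) := forall c : C, span j (s *: c).
have span0 j : span j 0.
  by exists (fun=> 0); rewrite big1 // => i _; rewrite scale0r.
have spanD j a y z : span j y -> span j z -> span j (a *: y + z).
  move=> [c ->] [d ->]; exists (fun i => a * c i + d i).
  rewrite scaler_sumr -big_split; apply: eq_bigr => i _.
  by rewrite scalerDl scalerA.
pose P j := `[< exists2 s, kills j s & s *: x <> 0 >].
have Pm : exists j, P j.
  exists m; apply/asboolP; exists 1; last by rewrite scale1r.
  move=> c; have [d dE] := gE c; exists d; rewrite scale1r dE.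
  by apply: eq_bigl => i; rewrite ltn_ord.
have [[|j] /asboolP [s sk sx] jmin] := ex_minnP Pm.
  case: sx; rewrite (faith s) ?scale0r // => c.
  by have [d ->] := sk c; rewrite big_pred0.
have killsj t : kills j t -> t *: x = 0.
  move=> tk; apply: contrapT => tx.
  have /jmin : P j by apply/asboolP; exists t.
  by rewrite ltnn.
(* Otherwise the spans for [j] and [j.+1] coincide, against minimality. *)
have jm : (j < m)%N.
  rewrite ltnNge; apply/negP => mj; apply: sx; apply: killsj => c.
  have [d ->] := sk c; exists d; apply: eq_bigl => i.
  by rewrite !(leq_trans (ltn_ord i)) // leqW.
pose gj := g (Ordinal jm).
have quot c : exists r : R, span j (s *: c - r *: gj).
  have [d dE] := sk c; exists (d (Ordinal jm)), d.
  rewrite dE (bigD1 (Ordinal jm)) //= addrC addrK; apply: eq_bigl => i.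
  by rewrite ltnS [RHS]ltn_neqAle andbC -val_eqE.
(* As [s] carries [C] into the span plus multiples of [gj], such a [t] makes [t * s] kill the
   quotient, hence [x]; since Ann(x) is prime and omits [s], it contains [t]. *)
have span_gj t : span j (t *: gj) -> t *: x = 0.
  move=> tg; have /prime_x [//|//] : (t * s) *: x = 0.
  apply: killsj => c; have [r rE] := quot c.
  have -> : (t * s) *: c = t *: (s *: c - r *: gj) + (r *: (t *: gj) + 0).
    by rewrite addr0 scalerBr !scalerA [r * t]mulrC subrK.
  exact: (spanD _ _ _ _ rE (spanD _ _ _ _ tg (span0 j))).
have [r rE] := choice quot.
have lv : linear (fun c => r c *: x).
  move=> a c d; apply/eqP; rewrite scalerA -scalerDl -subr_eq0 -scalerBl.
  apply/eqP/span_gj.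
  have -> : (r (a *: c + d) - (a * r c + r d)) *: gj =
      (-1) *: (s *: (a *: c + d) - r (a *: c + d) *: gj) +
      (a *: (s *: c - r c *: gj) + (1 *: (s *: d - r d *: gj) + 0)).
    rewrite addr0 scale1r scaleN1r scalerBl scalerDl -(scalerA a (r c)).
    rewrite scalerDr (scalerA s a) (mulrC s) -(scalerA a s c) scalerBr opprB.
    by rewrite [X in _ = _ + X]addrACA -opprD addrA subrK.
  apply: (spanD _ _ _ _ (rE _)); apply: (spanD _ _ _ _ (rE c)).
  exact: (spanD _ _ _ _ (rE d) (span0 j)).
have [v vE] := linear_of_fun lv; exists v, gj; rewrite vE => rx.
(* Applied to [gj] itself: [s - r gj] lies in Ann(x), so if [r gj] did too then [s] would. *)
apply: sx; have := span_gj (s - r gj).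
by rewrite !scalerBl rx subr0; apply; exact: rE.
Qed.

End AssociatedPrime.

(** * Comparison of Ext into [C] with Ext into [R] *)

Section GradeComparison.
Variables (R : comPzRingType) (C : lmodType R).
Hypothesis hC : semidualizing C.
Implicit Types A B K M N P Q S U V W X Y Z E : lmodType R.

(* For a complex of projectives [T], [B] is the module of [k]-coboundaries of
   [Hom(T, C)]: it inherits [Ext(C, -)]-acyclicity from [C] as long as
   [Hom(T, C)] is exact below [k]. *)
Lemma coboundaries_acyclic (T : nat -> lmodType R)
    (D : forall i, {linear T i.+1 -> T i}) k :
  (forall i, projective (T i)) ->
  (forall h : Defs.Hom (T 0) C, precomp C (D 0) h = 0 -> h = 0) ->
  (forall i, (i < k)%N -> exact_at (precomp C (D i)) (precomp C (D i.+1))) ->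
  exists (B : lmodType R) (b : {linear B -> Defs.Hom (T k.+1) C})
    (d : {linear Defs.Hom (T k) C -> B}),
    [/\ injective b, acyclic B C, surj d, (forall h, b (d h) = precomp C (D k) h) &
        forall u : {linear C -> B}, exists t : {linear C -> Defs.Hom (T k) C},
          forall c, d (t c) = u c].
Proof.
move=> pT D0; elim: k => [|k IH] Dex.
  have dinj : injective (precomp C (D 0)) by exact: linear_inj0.
  exists (Defs.Hom (T 0) C), (precomp C (D 0)), idfun; split=> // [|y|u].
  - exact/acyclic_Hom/semidualizing_acyclic.
  - by exists y.
  - by exists u.
have [B [b [d [bi Ba ds bd _]]]] := IH (fun i ik => Dex i (ltnW ik)).
set A := Defs.Hom (T k.+1) C.
have exb : exact_at b (precomp C (D k.+1)).
  move=> h; rewrite (Dex k (leqnn _)); split=> [[g <-]|[y <-]].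
    by exists (d g).
  by have [g <-] := ds y; exists g; exact/esym/bd.
have exc : exact_at (precomp C (D k.+1)) (quotmod_pi (im_pred (precomp C (D k.+1)))).
  exact: coker_pi0.
have [I [g [k' [sg sk kg]]]] := two_step_ses bi exb exc (@quotmod_pi_surj _ _ _).
have [_ gs _] := sg; have [k'i _ _] := sk.
exists I, k', g; split=> // [|u].
  apply: (acyclic_quotient sg Ba); apply: acyclic_Hom => //.
  exact: semidualizing_acyclic.
exact: (hom_lift u sg (acyclic_ext1_null Ba)).
Qed.

Hypothesis hR : noetherian R.

Lemma semidualizing_hom X : ~ is_zero X ->
  exists (v : {linear C -> X}) (c : C), v c <> 0.
Proof.
apply: (nonzero_hom hR); first by have [] := hC.
move=> a ac; apply: (semidualizing_faithful hC) => c.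
by rewrite ac scale0r.
Qed.

Lemma homology_ses U V W B (f : {linear U -> V}) (g : {linear V -> W})
    (b : {linear B -> V}) :
  injective b -> (forall x, g (f x) = 0) ->
  (forall y, (exists x, f x = y) <-> (exists x, b x = y)) ->
  exists Z (z : {linear Z -> V}) (b' : {linear B -> Z})
      (q : {linear Z -> homology f g}),
    [/\ ses b' q, injective z, forall x, z (b' x) = b x & forall x, g (z x) = 0].
Proof.
move=> bi gf imE.
have zi : injective (val : {linear ker_mod g -> V}) by exact: val_inj.
have [|b' b'E] := linear_lift (g := b) zi.
  move=> x; have [u uE] : exists u, f u = b x by apply/imE; exists x.
  have bk : b x \in ker_pred g by apply/eqP; rewrite -uE.
  by exists (Submod bk).
exists (ker_mod g), val, b', (quotmod_pi _); split=> // [|x]; last first.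
  exact/eqP/(valP x).
split=> [x y /(congr1 val)||y]; first by rewrite !b'E => /bi.
  exact: quotmod_pi_surj.
rewrite quotmod_pi0; split=> [/asboolP/imE [x xE]|[x <-]].
  by exists x; apply: val_inj; rewrite b'E.
by apply/asboolP/imE; exists x; rewrite -b'E.
Qed.

(** Hom(T, R) is Hom(C, -) applied to Hom(T, C). As Ext^1(C, B) = 0 for the coboundaries [B], maps
    from [C] to the homology lift to cocycles, so the scalar homology is Hom(C, -) of the other; and
    Hom(C, -) detects nonzero modules. *)
Lemma homology_dual_scalar (T : nat -> lmodType R)
    (D : forall i, {linear T i.+1 -> T i}) k :
  (forall i, projective (T i)) -> (forall i x, D i (D i.+1 x) = 0) ->
  (forall h : Defs.Hom (T 0) C, precomp C (D 0) h = 0 -> h = 0) ->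
  (forall i, (i < k)%N -> exact_at (precomp C (D i)) (precomp C (D i.+1))) ->
  is_zero (homology (precomp C (D k)) (precomp C (D k.+1))) <->
  is_zero (homology (precomp R^o (D k)) (precomp R^o (D k.+1))).
Proof.
move=> pT DD D0 Dex.
have [B [b [d [bi Ba ds bd lift_d]]]] := coboundaries_acyclic pT D0 Dex.
rewrite [X in _ <-> X]is_zero_homology; split=> [/is_zero_homology C0 w w0|R0].
  have w0x x : hom_fun w (D k.+1 x) = 0.
    exact: (congr1 (fun f => hom_fun f x) w0).
  have [u uE] := form_scalar C (hom_fun w : {linear T k.+1 -> R^o}).
  have [|u' u'E] := linear_lift (g := u) bi.
    move=> c; have [|g gE] := C0 (u c); last by exists (d g); rewrite bd.
    apply: homP => x; apply: etrans (uE c (D k.+1 x)) _.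
    exact: etrans (congr1 (fun a : R => a *: c) (w0x x)) (scale0r c).
  have [t tE] := lift_d u'; have [r rE] := scalar_form hC t.
  exists (to_hom (linearP r)); apply: homP => x /=.
  apply: (semidualizing_faithful hC) => c.
  by rewrite -rE -uE -u'E -tE bd.
apply: contrapT => /semidualizing_hom [v [c vc]]; apply: vc.
have [|y|Z [z [b' [q [sq zi zb' gz]]]]] :=
    homology_ses (f := precomp C (D k)) (g := precomp C (D k.+1)) bi.
- by move=> h; apply: homP => x; rewrite /= DD linear0.
- split=> [[x <-]|[x <-]]; first by exists (d x).
  by have [h <-] := ds x; exists h; exact/esym/bd.
have [u uE] := hom_lift v sq (acyclic_ext1_null Ba).
have [w wE] := scalar_form hC (z \o u : {linear C -> Defs.Hom (T k.+1) C}).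
have [|r rE] := R0 (to_hom (linearP w)).
  apply: homP => x /=; apply: (semidualizing_faithful hC) => e.
  rewrite -wE scale0r /=.
  exact: (congr1 (fun f => hom_fun f x) (gz (u e))).
rewrite -uE; have [_ _ exq] := sq; apply/exq.
have [s sE] := form_scalar C (hom_fun r : {linear T k -> R^o}).
exists (d (s c)); apply: zi; rewrite zb' bd; apply: homP => x.
apply: etrans (sE c (D k x)) _; apply: etrans _ (esym (wE c x)).
congr (_ *: _); exact: (congr1 (fun f => hom_fun f x) rE).
Qed.

(** Positive degrees apply [homology_dual_scalar] to the standard resolution; degree 0 compares
    Hom(E, R) with Hom(C, Hom(E, C)). *)
Lemma Ext_null_self_scalar E k :
  (forall i, (i < k)%N -> is_zero (Ext E C i)) ->
  is_zero (Ext E C k) <-> is_zero (Ext E R^o k).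
Proof.
case: k => [_|k E0]; last first.
  have DD i x : std_diff E i (std_diff E i.+1 x) = 0.
    by apply/(@std_exactS _ E); exists x.
  apply: (homology_dual_scalar (D := @std_diff R E)) => //.
  - by move=> i; exact: free_projective.
  (* In degree 0 the incoming map is [\0], so a cocycle, being a coboundary, is zero. *)
  - move=> h dh; have /is_zero_homology/(_ h dh) [g <-] := E0 0 isT.
    by [].
  move=> i ik h; split=> [dh|[g <-]].
    by have /is_zero_homology/(_ h dh) := E0 i.+1 ik.
  apply: homP => x.
  exact: etrans (congr1 (hom_fun g) (DD i x)) (linear0 (hom_fun g)).
rewrite !Ext0_null; split=> [C0 f x|R0].
  apply: (semidualizing_faithful hC) => c; have [u uE] := form_scalar C f.
  by rewrite -uE scale0r; exact: (C0 (hom_fun (u c) : {linear E -> C})).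
suff HomC0 : is_zero (Defs.Hom E C).
  move=> f x.
  exact: (congr1 (fun h => hom_fun h x) (HomC0 (to_hom (linearP f)))).
apply: contrapT => /semidualizing_hom [v [c vc]]; apply: vc; apply: homP => x.
have [w wE] := scalar_form hC v.
by rewrite wE R0 scale0r.
Qed.

End GradeComparison.

(** * Infima of predicates on the natural numbers *)

Section InfNat.
Implicit Types P Q : nat -> Prop.

Lemma inf_natP P n :
  inf_nat P = n%:E <-> P n /\ forall i, (i < n)%N -> ~ P i.
Proof.
rewrite /inf_nat; case: pselect => [exP|noP]; last first.
  by split=> // -[Pn _]; case: noP; exists n; apply/asboolP.
case: ex_minnP => m /asboolP Pm mmin; split=> [[<-]|[Pn nmin]].
  by split=> // i im Pi; move: im; rewrite ltnNge mmin //; apply/asboolP.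
have nm : (n <= m)%N by rewrite leqNgt; apply/negP => /nmin.
have mn : (m <= n)%N by apply: mmin; apply/asboolP.
by have -> : m = n by apply/eqP; rewrite eqn_leq mn nm.
Qed.

Lemma inf_nat_infty P : inf_nat P = +oo%E <-> forall i, ~ P i.
Proof.
rewrite /inf_nat; case: pselect => [exP|noP]; split=> //.
  by move=> H; have [i /asboolP /H] := exP.
by move=> _ i Pi; apply: noP; exists i; apply/asboolP.
Qed.

Lemma inf_nat_cases P : (exists n, inf_nat P = n%:E) \/ inf_nat P = +oo%E.
Proof. by rewrite /inf_nat; case: pselect => ?; [left; eexists|right]. Qed.

(** The equivalence is asked only up to the first index where [P] holds, the range in which Ext into
    [C] and into [R] can be compared. *)
Lemma eq_inf_nat P Q :
  (forall k, (forall i, (i < k)%N -> ~ P i) -> P k <-> Q k) ->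
  inf_nat P = inf_nat Q.
Proof.
move=> PQ; have nQ k : (forall i, (i < k)%N -> ~ P i) ->
    forall i, (i < k)%N -> ~ Q i.
  move=> nP i ik; rewrite -PQ; first exact: nP.
  by move=> j ji; apply: nP (ltn_trans ji ik).
case: (inf_nat_cases P) => [[n Pn]|Poo]; apply/esym.
  rewrite Pn; apply/inf_natP; have /inf_natP [Pn' nmin] := Pn.
  by split; [apply/PQ|exact: nQ].
rewrite Poo; apply/inf_nat_infty => i; have /inf_nat_infty noP := Poo.
by apply: (nQ i.+1) => // j _; exact: noP.
Qed.

(** A least index [k.+1] for [P] corresponds to [n + k] for [Q], whence the final 1; if [P] never
    holds, both sides are infinite. *)
Lemma inf_nat_shift P Q n : ~ P 0%N -> (forall i, (i < n)%N -> ~ Q i) ->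
  (forall i, P i.+1 <-> Q (n + i)%N) ->
  (n%:E + inf_nat P = inf_nat Q + 1%N%:E)%E.
Proof.
move=> P0 Qn PQ; case: (inf_nat_cases P) => [[[|k] Pk]|Poo].
- by have /inf_natP [] := Pk.
- have /inf_natP [Pk' kmin] := Pk; rewrite Pk.
  have -> : inf_nat Q = (n + k)%N%:E.
    apply/inf_natP; split; first exact/PQ.
    move=> i ink; have [/Qn //|ni] := ltnP i n.
    rewrite -(subnKC ni) -PQ; apply: kmin.
    by rewrite ltnS ltn_subLR.
  by rewrite -[LHS]/((n + k.+1)%N%:E) -[RHS]/((n + k + 1)%N%:E) addn1 addnS.
have -> : inf_nat Q = +oo%E.
  apply/inf_nat_infty => i; have [/Qn //|ni] := ltnP i n.
  by rewrite -(subnKC ni) -PQ; have /inf_nat_infty := Poo; apply.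
by rewrite Poo.
Qed.

End InfNat.

Theorem proposition4p2 (R : comPzRingType)
    (hnoeth : noetherian R) (hsemi : semiperfect R)
    (C : lmodType R) (hC : semidualizing C)
    (M : lmodType R) (n : nat)
    (hM : reduced_GC_perfect C M) (hn : GCdim C M = n%:E)
    (P1 P0 : lmodType R) (f : {linear P1 -> P0}%R) (e : {linear P0 -> M}%R)
    (hpres : finite_presentation f e) :
  (rgrade M C + rgrade (Tr C f) C)%E = (grade (Ext M C n) + 1%N%:E)%E.
Proof.
have [_ _ rn] := hM; rewrite hn in rn; rewrite rn.
have [[n0 nz] nmin] := (inf_natP _ _).1 rn.
have [gn _] := (inf_natP _ _).1 hn.
have [[fP1 pP1] [fP0 pP0] exfe es] := hpres.
(* The reduced grade ranges over positive degrees, so [n0] excludes [n = 0]. *)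
case: n => [//|n] in rn n0 nz nmin hn gn *.
have M0 j : (j < n)%N -> is_zero (Ext M C j.+1).
  by move=> jn; apply: contrapT => H; apply: (nmin j.+1).
have [E0 En] := Ext_Ext_GC gn M0 (lmod_iso_refl _).
(* Both sides are equivalent to [bidual_null C M i]. *)
have TrE i : is_zero (Ext (Tr C f) C i.+1) <->
    is_zero (Ext (Ext M C n.+1) C (n.+1 + i)).
  rewrite En; apply: (Ext_Tr i exfe es);
    exact: reflexive_acyclic_projective.
have -> : grade (Ext M C n.+1) =
    inf_nat (fun i => ~ is_zero (Ext (Ext M C n.+1) C i)).
  apply/esym/eq_inf_nat => k Ek.
  rewrite (Ext_null_self_scalar hC hnoeth) // => i ik.
  by apply: contrapT; exact: Ek.
apply: inf_nat_shift => [[]//|i /E0 Ei|i]; first by apply.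
by rewrite -TrE; split=> [[]//|].
Qed.
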